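(* Suppose there is a robust polynomial-time algorithm $\mathcal A$ for $\gamma$-stable instances of Max Cut with $\gamma\ge\gamma(n)$ (i.e. robust for $\gamma(n)$-stable instances on $n$ vertices). Then there is a polynomial-time algorithm $\mathcal B$ for the decision version of Sparsest Cut with the promise that either $\phi^*=\min_{(A,\bar A)}\phi(A)<\phi_0$ or $\phi^*>\gamma(2n)\phi_0$: given a Sparsest Cut instance on $n$ vertices and $\phi_0>0$ satisfying the promise, $\mathcal B$ decides which of $\phi^*<\phi_0$ or $\phi^*>\gamma(2n)\phi_0$ holds.
   Context: Max Cut: given $G=(V,E,w)$ with non-negative weights, maximize $w(E(S,\bar S))$ over $S\subseteq V$. $G$ with maximum cut $(S,\bar S)$ is $\gamma$-stable if for every $T\ne S,\bar S$: $w(E(S,\bar S)\setminus E(T,\bar T))>\gamma\,w(E(T,\bar T)\setminus E(S,\bar S))$. A robust algorithm for $\gamma$-stable instances outputs a maximum cut on $\gamma$-stable inputs, and on other inputs outputs either a maximum cut or a symbol $\perp$. Sparsest Cut with non-uniform demands: a connected graph $(V_0,E_c)$ with positive capacities, demand pairs $E_d$ with positive demands; sparsity $\phi(A)=\mathrm{cap}(E_c(A,\bar A))/\mathrm{dem}(E_d(A,\bar A))$ of a cut $(A,\bar A)$, where these are the total capacity of capacity edges and total demand of demand pairs separated by the cut. *)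

(* Defs.v *)
From HB Require Import structures.
From mathcomp Require Import all_boot all_order all_algebra.
From mathcomp Require Import constructive_ereal reals.

Set Implicit Arguments.
Unset Strict Implicit.
Unset Printing Implicit Defensive.

Import Order.TTheory GRing.Theory Num.Theory.

(* Model of computation: a WHILE language over S-expressions whose atoms are
   natural numbers in binary, with logarithmic cost (evaluating an expression
   costs the total bit size of the values of all its subexpressions).  Every
   operation on values of total size s is feasible in time poly(s) on a Turing
   machine, and a value is charged its full size each time it is built or
   read, so polynomial time here is polynomial time on Turing machines. *)

Inductive value : Type :=
| Num of nat
| Cons of value & value.

Fixpoint vsize (v : value) : nat :=
  match v with
  | Num k => (trunc_log 2 k).+1
  | Cons a b => (vsize a + vsize b).+1
  end.

Definition vfst (v : value) : value := if v is Cons a _ then a else Num 0.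
Definition vsnd (v : value) : value := if v is Cons _ b then b else Num 0.
Definition vnum (v : value) : nat := if v is Num k then k else 0.
Definition truthy (v : value) : bool := if v is Num 0 then false else true.

(* ESub is truncated subtraction and EDiv Euclidean division (0 when the
   divisor is 0); arithmetic treats a pair as 0. *)
Inductive expr : Type :=
| EVar of nat
| ENum of nat
| ECons of expr & expr
| EFst of expr
| ESnd of expr
| EIsCons of expr
| EAdd of expr & expr
| ESub of expr & expr
| EMul of expr & expr
| EDiv of expr & expr
| ELeq of expr & expr.

Definition store : Type := nat -> value.

Definition update (s : store) (x : nat) (v : value) : store :=
  fun y => if y == x then v else s y.

Definition init_store (v : value) : store := update (fun=> Num 0) 0 v.

Fixpoint eval (s : store) (e : expr) : value :=
  match e with
  | EVar x => s x
  | ENum k => Num k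
  | ECons a b => Cons (eval s a) (eval s b)
  | EFst a => vfst (eval s a)
  | ESnd a => vsnd (eval s a)
  | EIsCons a => Num (if eval s a is Cons _ _ then 1 else 0)
  | EAdd a b => Num (vnum (eval s a) + vnum (eval s b))
  | ESub a b => Num (vnum (eval s a) - vnum (eval s b))
  | EMul a b => Num (vnum (eval s a) * vnum (eval s b))
  | EDiv a b => Num (vnum (eval s a) %/ vnum (eval s b))
  | ELeq a b => Num (vnum (eval s a) <= vnum (eval s b))
  end.

Fixpoint ecost (s : store) (e : expr) : nat :=
  vsize (eval s e) +
  match e with
  | EVar _ | ENum _ => 0
  | EFst a | ESnd a | EIsCons a => ecost s a
  | ECons a b | EAdd a b | ESub a b | EMul a b | EDiv a b | ELeq a b =>
      ecost s a + ecost s b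
  end.

(* [Call x c e] runs the subroutine [c] on the value of [e] in a fresh store
   and assigns its output to [x]. *)
Inductive program : Type :=
| Assign of nat & expr
| Seq of program & program
| If of expr & program & program
| While of expr & program
| Call of nat & program & expr.

(* [exec c s s' t]: from store [s], [c] halts in store [s'] in time [t].
   Variable 0 holds the input and the output. *)
Inductive exec : program -> store -> store -> nat -> Prop :=
| exec_assign x e s :
    exec (Assign x e) s (update s x (eval s e)) (ecost s e)
| exec_seq c1 c2 s s1 s2 t1 t2 :
    exec c1 s s1 t1 -> exec c2 s1 s2 t2 -> exec (Seq c1 c2) s s2 (t1 + t2)
| exec_if e c1 c2 s s' t :
    exec (if truthy (eval s e) then c1 else c2) s s' t ->
    exec (If e c1 c2) s s' (ecost s e + t)
| exec_while_false e c s :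
    ~~ truthy (eval s e) -> exec (While e c) s s (ecost s e)
| exec_while_true e c s s1 s2 t1 t2 :
    truthy (eval s e) -> exec c s s1 t1 -> exec (While e c) s1 s2 t2 ->
    exec (While e c) s s2 (ecost s e + t1 + t2)
| exec_call x c e s s' t :
    exec c (init_store (eval s e)) s' t ->
    exec (Call x c e) s (update s x (s' 0)) (ecost s e + t + vsize (s' 0)).

Lemma exec_det c s s1 t1 : exec c s s1 t1 ->
  forall s2 t2, exec c s s2 t2 -> s1 = s2 /\ t1 = t2.
Proof.
elim=> {c s s1 t1}
  [x e s|c1 c2 s s1 s2 t1 t2 _ IH1 _ IH2|e c1 c2 s s' t _ IH|e c s /negP nHe
  |e c s s1 s2 t1 t2 He _ IH1 _ IH2|x c e s s' t _ IH] s3 t3 H;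
  inversion H; subst=> //;
  repeat match goal with
  | IHa : forall s t, exec ?c ?s0 s t -> _, K : exec ?c ?s0 _ _ |- _ =>
      case: (IHa _ _ K) => ? ?; subst; clear K
  | K : is_true (~~ _) |- _ => move/negP: K => K
  end; by [|congruence].
Qed.

Definition runs (c : program) (v w : value) (t : nat) : Prop :=
  exists2 s : store, exec c (init_store v) s t & s 0 = w.

Definition outputs (c : program) (v w : value) : Prop :=
  exists t : nat, runs c v w t.

Definition polytime (X : Type) (enc : X -> value) (c : program) : Prop :=
  exists p : {poly nat}, forall x : X, exists w : value, exists2 t : nat,
    runs c (enc x) w t & t <= p.[vsize (enc x)]%R.

Local Open Scope ring_scope.

Record wgraph (n : nat) : Type := WGraph {
  adj : rel 'I_n;
  wt : 'I_n -> 'I_n -> rat;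
  adj_sym : symmetric adj;
  adj_irr : irreflexive adj;
  wt_sym : forall u v, wt u v = wt v u
}.

(* Every edge {u, v} is represented once, by the pair (u, v) with u < v. *)
Definition cut_edges (n : nat) (G : wgraph n) (S : {set 'I_n}) :
    {set 'I_n * 'I_n} :=
  [set p : 'I_n * 'I_n | [&& (p.1 < p.2)%N, adj G p.1 p.2 &
                         (p.1 \in S) != (p.2 \in S)]].

Definition total_wt (n : nat) (G : wgraph n) (F : {set 'I_n * 'I_n}) : rat :=
  \sum_(p in F) wt G p.1 p.2.

Definition cut_wt (n : nat) (G : wgraph n) (S : {set 'I_n}) : rat :=
  total_wt G (cut_edges G S).

Record maxcut_instance : Type := MaxCutInstance {
  mc_n : nat;
  mc_graph : wgraph mc_n;
  mc_wt_ge0 : forall u v, adj mc_graph u v -> 0 <= wt mc_graph u v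
}.

Definition is_max_cut (n : nat) (G : wgraph n) (S : {set 'I_n}) : Prop :=
  forall T : {set 'I_n}, cut_wt G T <= cut_wt G S.

Definition stable (R : realType) (gamma : R) (n : nat) (G : wgraph n) : Prop :=
  exists2 S : {set 'I_n}, is_max_cut G S &
    forall T : {set 'I_n}, T <> S -> T <> ~: S ->
      ratr (total_wt G (cut_edges G S :\: cut_edges G T)) >
      gamma * ratr (total_wt G (cut_edges G T :\: cut_edges G S)).

(* [sc_phi0] is the threshold of the decision version. *)
Record sparsest_cut_instance : Type := SparsestCutInstance {
  sc_n : nat;
  sc_cap : wgraph sc_n;
  sc_dem : wgraph sc_n;
  sc_phi0 : rat;
  sc_connected : forall u v, connect (adj sc_cap) u v;
  sc_cap_gt0 : forall u v, adj sc_cap u v -> 0 < wt sc_cap u v;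
  sc_dem_gt0 : forall u v, adj sc_dem u v -> 0 < wt sc_dem u v;
  sc_phi0_gt0 : 0 < sc_phi0
}.

(* A cut separating no demand has sparsity +oo: its capacity is positive,
   since the capacity graph is connected.  The minimum over no cut (at most one
   vertex) is +oo as well. *)
Definition sparsity (R : realType) (I : sparsest_cut_instance)
    (A : {set 'I_(sc_n I)}) : \bar R :=
  if cut_wt (sc_dem I) A == 0 then +oo%E
  else (ratr (cut_wt (sc_cap I) A / cut_wt (sc_dem I) A))%:E.

Definition min_sparsity (R : realType) (I : sparsest_cut_instance) : \bar R :=
  \big[Order.min/+oo%E]_(A : {set 'I_(sc_n I)} | (A != set0) && (A != setT))
    sparsity R A.

Definition below_threshold (R : realType) (I : sparsest_cut_instance) : Prop :=
  (min_sparsity R I < (ratr (sc_phi0 I))%:E)%E.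

Definition above_gap (R : realType) (gamma : nat -> R)
    (I : sparsest_cut_instance) : Prop :=
  ((gamma (2 * sc_n I)%N * ratr (sc_phi0 I))%:E < min_sparsity R I)%E.

Definition enc_seq (s : seq value) : value := foldr Cons (Num 0) s.

(* Only applied to nonnegative rationals; lowest terms. *)
Definition enc_rat (q : rat) : value :=
  Cons (Num `|numq q|%N) (Num `|denq q|%N).

Definition enc_graph (n : nat) (G : wgraph n) : value :=
  Cons (Num n)
    (enc_seq [seq enc_seq [seq if adj G u v then enc_rat (wt G u v) else Num 0
                          | v <- enum 'I_n] | u <- enum 'I_n]).

Definition enc_maxcut (I : maxcut_instance) : value := enc_graph (mc_graph I).

Definition enc_sparsest_cut (I : sparsest_cut_instance) : value :=
  Cons (enc_rat (sc_phi0 I))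
       (Cons (enc_graph (sc_cap I)) (enc_graph (sc_dem I))).

Definition enc_cut (n : nat) (S : {set 'I_n}) : value :=
  Cons (Num 1) (enc_seq [seq Num (u \in S) | u <- enum 'I_n]).

Definition enc_bot : value := Num 0.

Definition robust_maxcut (R : realType) (gamma : nat -> R) (c : program) :
    Prop :=
  forall (I : maxcut_instance) (w : value), outputs c (enc_maxcut I) w ->
    (exists2 S : {set 'I_(mc_n I)}, is_max_cut (mc_graph I) S & w = enc_cut S)
    \/ (w = enc_bot /\ ~ stable (gamma (mc_n I)) (mc_graph I)).

(* When 1 <= gamma the two alternatives are exclusive, so the output is
   determined by which of them holds. *)
Definition decides_sparsest_cut (R : realType) (gamma : nat -> R)
    (c : program) : Prop :=
  forall I : sparsest_cut_instance,
    below_threshold R I \/ above_gap gamma I ->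
  forall w : value, outputs c (enc_sparsest_cut I) w ->
    (w = Num 1 /\ below_threshold R I) \/ (w = Num 0 /\ above_gap gamma I).

(* Main.v *)
Require Import Defs.
From mathcomp Require Import all_boot all_order all_algebra.
From mathcomp Require Import constructive_ereal reals.
From mathcomp Require Import zify ring.
(* mathcomp also defines [Num] and [Cons]; those of [Defs] are meant here. *)
Import Defs.

Set Implicit Arguments.
Unset Strict Implicit.
Unset Printing Implicit Defensive.

Import Order.TTheory GRing.Theory Num.Theory.

(* Join the two copies of every vertex by a heavy edge, put the capacity edges
   between the copies and the demand edges, with weights multiplied by phi0,
   inside each copy.  A cut separating all pairs of copies corresponds to a set
   A of vertices, and compared with the cut between the two copies it gains
   2 phi0 dem(A) and loses 2 cap(A).  Hence the cut between the copies is
   maximum exactly when phi* >= phi0, and above the gap the graph is stable, so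
   the robust algorithm must then answer with a maximum cut, of the same weight
   as the cut between the copies.  Below the threshold it answers with a
   heavier cut or with bottom.

   Weights are cleared of denominators, so that the reduction never has to bring
   a fraction to lowest terms.

   Polynomial time is obtained from a class of computable functions on values
   closed under composition and folds over lists.  A fold stays polynomial when
   each step enlarges the accumulator by an amount that does not depend on the
   accumulator. *)

(** * Polynomial bounds and program composition *)

(** With a base of at least 2, enlarging the exponent absorbs constants, sums and products, so a
    bound is a single number [k]. *)
Definition pbounded (X : Type) (m b : X -> nat) : Prop :=
  exists k, forall x, b x <= (m x).+2 ^ k.

Lemma pb_le (X : Type) (m b b' : X -> nat) :
  pbounded m b' -> (forall x, b x <= b' x) -> pbounded m b.
Proof. by move=> [k Hk] H; exists k => x; exact: leq_trans (H x) (Hk x). Qed.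

Lemma pb_const (X : Type) (m : X -> nat) c : pbounded m (fun=> c).
Proof.
exists c => x; apply: leq_trans (ltnW (ltn_expl c (ltnSn 1))) _.
by case: c => // c; rewrite leq_exp2r.
Qed.

Lemma pb_measure (X : Type) (m : X -> nat) : pbounded m m.
Proof. by exists 1 => x; rewrite expn1 -addn2 leq_addr. Qed.

Lemma pbM (X : Type) (m a b : X -> nat) :
  pbounded m a -> pbounded m b -> pbounded m (fun x => a x * b x).
Proof.
by move=> [i Hi] [j Hj]; exists (i + j) => x; rewrite expnD leq_mul.
Qed.

Lemma pbX (X : Type) (m a : X -> nat) k :
  pbounded m a -> pbounded m (fun x => a x ^ k).
Proof.
move=> [i Hi]; exists (i * k) => x; rewrite expnM.
by case: k => // k; rewrite leq_exp2r.
Qed.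

(** Both powers are at least 1, so their sum is at most twice their product; one more factor of the
    base pays for the 2. *)
Lemma pbD (X : Type) (m a b : X -> nat) :
  pbounded m a -> pbounded m b -> pbounded m (fun x => a x + b x).
Proof.
move=> [i Hi] [j Hj]; exists (i + j).+1 => x; rewrite expnS expnD.
have := Hi x; have := Hj x.
have: 0 < (m x).+2 ^ i by rewrite expn_gt0.
have: 0 < (m x).+2 ^ j by rewrite expn_gt0.
move: ((m x).+2 ^ i) ((m x).+2 ^ j) => p q; nia.
Qed.

Lemma pbS (X : Type) (m a : X -> nat) :
  pbounded m a -> pbounded m (fun x => (a x).+1).
Proof.
by move=> Ha; apply: pb_le (pbD Ha (pb_const m 1)) _ => x; rewrite addn1.
Qed.

Lemma pb_comp (X Y : Type) (m : X -> nat) (m' b : Y -> nat) (g : X -> Y) :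
  pbounded m' b -> pbounded m (fun x => m' (g x)) ->
  pbounded m (fun x => b (g x)).
Proof. by move=> [k Hk] /pbS/pbS/(pbX k) H; apply: pb_le H _. Qed.

Lemma vsize_gt0 v : 0 < vsize v. Proof. by case: v. Qed.

Lemma vsize_Num_ltn k n : 0 < n -> k < 2 ^ n -> vsize (Num k) <= n.
Proof.
move=> n0 kn /=; case: k kn => [|k] kn; first by rewrite trunc_log0.
by rewrite -(@ltn_exp2l 2) //; apply: leq_ltn_trans kn; apply: trunc_logP.
Qed.

Lemma ltn_vsize_Num k : k < 2 ^ vsize (Num k).
Proof. exact: trunc_log_ltn. Qed.

Lemma vsize_Num_mono i j : i <= j -> vsize (Num i) <= vsize (Num j).
Proof. by move=> ij /=; rewrite ltnS; apply: leq_trunc_log. Qed.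

Lemma vsize_Num_mul i j :
  vsize (Num (i * j)) <= vsize (Num i) + vsize (Num j).
Proof.
apply: vsize_Num_ltn; rewrite ?addn_gt0 ?vsize_gt0 //.
by rewrite expnD; apply: ltn_mul; exact: ltn_vsize_Num.
Qed.

Lemma vsize_Num_add i j :
  vsize (Num (i + j)) <= vsize (Num i) + vsize (Num j).
Proof.
apply: vsize_Num_ltn; rewrite ?addn_gt0 ?vsize_gt0 //.
have := ltn_vsize_Num i; have := ltn_vsize_Num j.
rewrite expnD; set p := 2 ^ _; set q := 2 ^ _.
have : 2 <= p by rewrite /p /= expnS leq_pmulr // expn_gt0.
have : 2 <= q by rewrite /q /= expnS leq_pmulr // expn_gt0.
nia.
Qed.

Lemma vsize_vnum v : vsize (Num (vnum v)) <= vsize v.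
Proof. by case: v => //= a b; rewrite trunc_log0. Qed.

Lemma vsize_fst v : vsize (vfst v) <= vsize v.
Proof. by case: v => [k|a b] //=; rewrite ?trunc_log0 //; lia. Qed.

Lemma vsize_snd v : vsize (vsnd v) <= vsize v.
Proof. by case: v => [k|a b] //=; rewrite ?trunc_log0 //; lia. Qed.

Lemma vsize_bool (b : bool) : vsize (Num b) = 1.
Proof. by case: b. Qed.

Lemma pb_eval (X : Type) (m : X -> nat) (s : X -> store) e :
  (forall y, pbounded m (fun x => vsize (s x y))) ->
  pbounded m (fun x => vsize (eval (s x) e)).
Proof.
move=> Hs; elim: e => [y|k|a Ha b Hb|a Ha|a Ha|a Ha|a Ha b Hb|a Ha b Hb
  |a Ha b Hb|a Ha b Hb|a Ha b Hb].
- exact: Hs.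
- exact: pb_const.
- exact/pbS/pbD.
- by apply: pb_le Ha _ => x; exact: vsize_fst.
- by apply: pb_le Ha _ => x; exact: vsize_snd.
- by apply: pb_le (pb_const m 1) _ => x /=; case: (eval _ _).
- apply: pb_le (pbD Ha Hb) _ => x; apply: leq_trans (vsize_Num_add _ _) _.
  exact: leq_add (vsize_vnum _) (vsize_vnum _).
- apply: pb_le Ha _ => x; apply: leq_trans (vsize_vnum _).
  exact/vsize_Num_mono/leq_subr.
- apply: pb_le (pbD Ha Hb) _ => x; apply: leq_trans (vsize_Num_mul _ _) _.
  exact: leq_add (vsize_vnum _) (vsize_vnum _).
- apply: pb_le Ha _ => x; apply: leq_trans (vsize_vnum _).
  exact/vsize_Num_mono/leq_div.
- by apply: pb_le (pb_const m 1) _ => x; rewrite /= -[(_.+1)]/(vsize (Num _)) vsize_bool.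
Qed.

Lemma pb_ecost (X : Type) (m : X -> nat) (s : X -> store) e :
  (forall y, pbounded m (fun x => vsize (s x y))) ->
  pbounded m (fun x => ecost (s x) e).
Proof.
move=> Hs; have H e' := pb_eval e' Hs.
by elim: e => [y|k|a Ha b Hb|a Ha|a Ha|a Ha|a Ha b Hb|a Ha b Hb
  |a Ha b Hb|a Ha b Hb|a Ha b Hb];
  apply: pbD; try exact: (H (EVar _)); try exact: (H (ENum _));
  try exact: pb_const; try exact: (H (ECons _ _)); try exact: (H (EFst _));
  try exact: (H (ESnd _)); try exact: (H (EIsCons _)); 
  try exact: (H (EAdd _ _)); try exact: (H (ESub _ _));
  try exact: (H (EMul _ _)); try exact: (H (EDiv _ _));
  try exact: (H (ELeq _ _)); try exact: pbD.
Qed.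

(** Building a value costs its size, so the running time bounds the growth of every variable, and
    size bounds on outputs follow from time bounds. *)
Lemma exec_vsize c s s' t : exec c s s' t ->
  forall y, vsize (s' y) <= vsize (s y) + t.
Proof.
elim=> {c s s' t}
  [x e s|c1 c2 s s1 s2 t1 t2 _ IH1 _ IH2|e c1 c2 s s' t _ IH|e c s _
  |e c s s1 s2 t1 t2 _ _ IH1 _ IH2|x c e s s' t _ IH] y.
- rewrite /update; case: eqP => _; last exact: leq_addr.
  by apply: leq_trans (leq_addl _ _); case: e => *; exact: leq_addr.
- by have := IH1 y; have := IH2 y; lia.
- by have := IH y; lia.
- exact: leq_addr.
- by have := IH1 y; have := IH2 y; lia.
- by rewrite /update; case: eqP => _; lia.
Qed.

(** Executions are indexed by an arbitrary type with a measure, not by input values: an index may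
    then carry further data, such as the answer of a subroutine. *)
Definition pexec (X : Type) (m : X -> nat) (s : X -> store) (c : program)
    (s' : X -> store) : Prop :=
  exists2 T, pbounded m T & forall x, exists2 t, exec c (s x) (s' x) t & t <= T x.

Definition computes (X : Type) (m : X -> nat) (c : program) (f g : X -> value) :
    Prop :=
  exists2 T, pbounded m T & forall x, exists2 t, runs c (f x) (g x) t & t <= T x.

Definition computable (f : value -> value) : Prop :=
  exists c, computes vsize c id f.

Lemma pexec_seq (X : Type) (m : X -> nat) s s1 s2 c1 c2 :
  @pexec X m s c1 s1 -> pexec m s1 c2 s2 -> pexec m s (Seq c1 c2) s2.
Proof.
move=> [T1 p1 H1] [T2 p2 H2]; exists (fun x => T1 x + T2 x); first exact: pbD.
move=> x; have [t1 E1 L1] := H1 x; have [t2 E2 L2] := H2 x.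
by exists (t1 + t2); [exact: exec_seq E1 E2|exact: leq_add].
Qed.

Lemma pexec_assign (X : Type) (m : X -> nat) (s : X -> store) y e :
  (forall z, pbounded m (fun x => vsize (s x z))) ->
  pexec m s (Assign y e) (fun x => update (s x) y (eval (s x) e)).
Proof.
move=> Hs; exists (fun x => ecost (s x) e); first exact: pb_ecost.
by move=> x; exists (ecost (s x) e) => //; exact: exec_assign.
Qed.

Lemma pexec_call (X : Type) (m : X -> nat) (s : X -> store) y c e g :
  (forall z, pbounded m (fun x => vsize (s x z))) ->
  computes m c (fun x => eval (s x) e) g ->
  pexec m s (Call y c e) (fun x => update (s x) y (g x)).
Proof.
move=> Hs [T pT H].
(* The last summand bounds the size of the returned value by input size plus running time. *)
exists (fun x => ecost (s x) e + T x + (vsize (eval (s x) e) + T x)).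
  by apply: pbD; apply: pbD => //; [exact: pb_ecost|exact: pb_eval].
move=> x; have [t [s' E <-] L] := H x.
exists (ecost (s x) e + t + vsize (s' 0)); first exact: exec_call.
by have := exec_vsize E 0; rewrite /= in E *; rewrite /init_store /update /=; lia.
Qed.

Lemma computes_comp (X : Type) (m : X -> nat) c f g (h : X -> value) :
  computes vsize c f g -> pbounded m (fun x => vsize (h x)) ->
  computes m c (fun x => f (h x)) (fun x => g (h x)).
Proof.
move=> [T pT H] Hh; exists (fun x => T (h x)) => //; exact: pb_comp pT Hh.
Qed.

Lemma pb_init (X : Type) (m : X -> nat) (f : X -> value) :
  pbounded m (fun x => vsize (f x)) ->
  forall y, pbounded m (fun x => vsize (init_store (f x) y)).
Proof.
move=> Hf y; rewrite /init_store /update; case: eqP => // _; exact: pb_const.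
Qed.

Lemma computes_exec (X : Type) (m : X -> nat) c (f g : X -> value) s' :
  pexec m (fun x => init_store (f x)) c s' -> (forall x, s' x 0 = g x) ->
  computes m c f g.
Proof.
move=> [T pT H] Hg; exists T => // x; have [t E L] := H x.
by exists t => //; exists (s' x).
Qed.

Lemma computes_size (X : Type) (m : X -> nat) c (f g : X -> value) :
  computes m c f g -> pbounded m (fun x => vsize (f x)) ->
  pbounded m (fun x => vsize (g x)).
Proof.
move=> [T pT H] Hf; apply: pb_le (pbD Hf pT) _ => x.
have [t [s E <-] L] := H x; have := exec_vsize E 0.
by rewrite /init_store /update /=; lia.
Qed.

Lemma computable_size f : computable f -> pbounded vsize (fun v => vsize (f v)).
Proof. by move=> [c /computes_size H]; apply: H; exact: pb_measure. Qed.

Lemma pb_update (X : Type) (m : X -> nat) (s : X -> store) y (g : X -> value) :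
  (forall z, pbounded m (fun x => vsize (s x z))) ->
  pbounded m (fun x => vsize (g x)) ->
  forall z, pbounded m (fun x => vsize (update (s x) y (g x) z)).
Proof. by move=> Hs Hg z; rewrite /update; case: eqP. Qed.

Lemma computable_expr e : computable (fun v => eval (init_store v) e).
Proof.
exists (Assign 0 e); apply: computes_exec; first
  by apply: pexec_assign; apply: pb_init; exact: pb_measure.
by [].
Qed.

Lemma computable_comp f g :
  computable f -> computable g -> computable (fun v => f (g v)).
Proof.
move=> [cf Hf] [cg Hg]; have Hv := pb_measure vsize.
exists (Seq (Call 0 cg (EVar 0)) (Call 0 cf (EVar 0))).
have S0 := pb_init Hv.
have S1 := pb_update 0 S0 (computes_size Hg Hv).
apply: computes_exec; first apply: pexec_seq.
- apply: (pexec_call _ (g := g)); first exact: S0.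
  by move: Hg; rewrite /computes.
- apply: (pexec_call _ (g := fun v => f (g v))); first exact: S1.
  by apply: (computes_comp Hf); exact: computes_size Hg Hv.
- by [].
Qed.

Lemma computable_cons f g :
  computable f -> computable g -> computable (fun v => Cons (f v) (g v)).
Proof.
move=> [cf Hf] [cg Hg]; have Hv := pb_measure vsize.
exists (Seq (Call 1 cf (EVar 0)) (Seq (Call 2 cg (EVar 0))
  (Assign 0 (ECons (EVar 1) (EVar 2))))).
have S0 := pb_init Hv.
have S1 := pb_update 1 S0 (computes_size Hf Hv).
have S2 := pb_update 2 S1 (computes_size Hg Hv).
apply: computes_exec; first apply: pexec_seq.
- exact: (pexec_call _ (g := f)).
- apply: pexec_seq; first exact: (pexec_call _ (g := g)).
  exact: pexec_assign.
- by [].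
Qed.

Lemma computable_if f g h :
  computable f -> computable g -> computable h ->
  computable (fun v => if truthy (f v) then g v else h v).
Proof.
move=> [cf Hf] [cg Hg] [ch Hh]; have Hv := pb_measure vsize.
exists (Seq (Call 1 cf (EVar 0))
  (If (EVar 1) (Call 0 cg (EVar 0)) (Call 0 ch (EVar 0)))).
have S0 := pb_init Hv.
have S1 := pb_update 1 S0 (computes_size Hf Hv).
apply: computes_exec; first apply: pexec_seq.
- exact: (pexec_call _ (g := f)).
- have [Tg pg Eg] := pexec_call (e := EVar 0) 0 S1 Hg.
  have [Th ph Eh] := pexec_call (e := EVar 0) 0 S1 Hh.
  (* The sum of both bounds covers either branch; [vsize (f v)] is the cost of reading the test. *)
  exists (fun v => vsize (f v) + (Tg v + Th v)).
    by apply: pbD (pbD pg ph); exact: computes_size Hf Hv.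
  instantiate (1 := fun v => update (update (init_store v) 1 (f v)) 0
    (if truthy (f v) then g v else h v)).
  move=> v; case: (boolP (truthy (f v))) => Hb.
  + have [t E L] := Eg v; exists (ecost (update (init_store v) 1 (f v)) (EVar 1) + t).
      by apply: exec_if; rewrite /= /update /= Hb.
    by rewrite /= /update /= addn0; lia.
  + have [t E L] := Eh v; exists (ecost (update (init_store v) 1 (f v)) (EVar 1) + t).
      by apply: exec_if; rewrite /= /update /= (negbTE Hb).
    by rewrite /= /update /= addn0; lia.
- by [].
Qed.

(** * Folds over lists *)

Fixpoint vlist (v : value) : seq value :=
  if v is Cons a b then a :: vlist b else [::].

(** Polynomial-time steps alone would not do: squaring a number at every element about doubles its
    length each time. Here the increment is polynomial in the context [c] and the element [x]
    only. *)
Definition grows_additively (F : value -> value -> value -> value) : Prop :=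
  exists k, forall c x a,
    vsize (F c x a) <= vsize a + (vsize c + vsize x).+2 ^ k.

Section FoldLoop.
Variables (F : value -> value -> value -> value) (cF : program).

(** Variable 1 holds the context, 2 the accumulator and 3 the rest of the list. *)
Definition fold_loop : program :=
  While (EIsCons (EVar 3))
    (Seq (Call 2 cF (ECons (EVar 1) (ECons (EFst (EVar 3)) (EVar 2))))
         (Assign 3 (ESnd (EVar 3)))).

Variables (c : value) (L P A K : nat).
Hypothesis F_size : forall x a,
  vsize x <= L -> vsize (F c x a) <= vsize a + P.
Hypothesis F_runs : forall x a, vsize x <= L -> vsize a <= A ->
  exists2 t, runs cF (Cons c (Cons x a)) (F c x a) t & t <= K.

(** The invariant reserves [P] for each unit of size of the remaining list, which has at least as
    many units as elements; so every accumulator stays within [A] and every call of [cF] within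
    [K]. *)
Lemma fold_loop_exec l (s : store) :
  s 1 = c -> s 3 = l -> vsize l <= L -> vsize (s 2) + vsize l * P <= A ->
  exists s', exists2 t, exec fold_loop s s' t &
    s' 2 = foldl (fun a x => F c x a) (s 2) (vlist l) /\
    t <= vsize l * (20 + 2 * vsize c + 8 * L + 4 * A + 2 * K).
Proof.
elim: l s => [k|x _ l IH] s s1 s3 lL szA.
  exists s; exists (ecost s (EIsCons (EVar 3))).
    by apply: exec_while_false; rewrite /= s3.
  by split=> //; rewrite [ecost _ _]/= s3 /= ?trunc_log0 ?trunc_log1; nia.
rewrite /= in lL szA *.
have xL : vsize x <= L by lia.
have aA : vsize (s 2) <= A by lia.
have [t [u E u0] tK] := F_runs xL aA.
have szF := F_size (s 2) xL.
have FA : vsize (F c x (s 2)) <= A by clear -szF szA; nia.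
set e := ECons (EVar 1) (ECons (EFst (EVar 3)) (EVar 2)).
have ev : eval s e = Cons c (Cons x (s 2)) by rewrite /= s1 s3.
pose s4 := update s 2 (u 0).
pose s5 := update s4 3 (eval s4 (ESnd (EVar 3))).
have E1 : exec (Call 2 cF e) s s4 (ecost s e + t + vsize (u 0)).
  by apply: exec_call; rewrite ev.
have s53 : s5 3 = l by rewrite /s5 /s4 /update /= s3.
have s52 : s5 2 = F c x (s 2) by [].
have [] := IH s5 s1 s53; rewrite ?s52; [lia|nia|].
move=> s' [t' E' [s'2 t'L]].
exists s'; exists (ecost s (EIsCons (EVar 3)) +
    (ecost s e + t + vsize (u 0) + ecost s4 (ESnd (EVar 3))) + t').
  apply: exec_while_true E'; first by rewrite /= s3.
  by apply: exec_seq E1 _; exact: exec_assign.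
split=> //; rewrite /= /s4 /update /= s1 s3 u0 /= ?trunc_log0 ?trunc_log1.
(* The cons cell adds one unit to the size of the list, and that unit pays for this iteration. *)
rewrite [X in _ <= X]mulSn mulnDl; move: t'L; set K' := 20 + _ + _ + _ + _.
move: (vsize x * K') (vsize l * K') => X Y; rewrite /K'.
clear -FA aA lL tK xL; lia.
Qed.

End FoldLoop.

Lemma computable_fold F :
  computable (fun w => F (vfst w) (vfst (vsnd w)) (vsnd (vsnd w))) ->
  grows_additively F ->
  computable (fun w =>
    foldl (fun a x => F (vfst w) x a) (vfst (vsnd w)) (vlist (vsnd (vsnd w)))).
Proof.
move=> [cF [T [k Tk] HT]] [g Hg].
(* Context and elements are parts of [w], hence of size at most [vsize w]. In [K], the four extra
   units are the two cons cells of the argument of [cF] and the 2 in the base of [pbounded]. *)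
pose P w := (vsize w + vsize w).+2 ^ g.
pose A w := vsize w + vsize w * P w.
pose K w := (vsize w + vsize w + A w).+4 ^ k.
have Hv := pb_measure vsize.
have pP : pbounded vsize P by apply: pbX; do 2 apply: pbS; exact: pbD.
have pA : pbounded vsize A by apply: pbD => //; exact: pbM.
have pK : pbounded vsize K.
  by apply: pbX; do 4 apply: pbS; apply: pbD => //; exact: pbD.
exists (Seq (Seq (Assign 1 (EFst (EVar 0))) (Seq (Assign 2 (EFst (ESnd (EVar 0))))
  (Assign 3 (ESnd (ESnd (EVar 0)))))) (Seq (fold_loop cF) (Assign 0 (EVar 2)))).
have S0 := pb_init Hv.
have [T1 pT1 H1] : pexec vsize (fun v => init_store v)
  (Seq (Assign 1 (EFst (EVar 0))) (Seq (Assign 2 (EFst (ESnd (EVar 0))))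
  (Assign 3 (ESnd (ESnd (EVar 0)))))) (fun w =>
   update (update (update (init_store w) 1 (vfst w)) 2 (vfst (vsnd w)))
    3 (vsnd (vsnd w))).
  have S1 := pb_update 1 S0 (pb_le Hv vsize_fst).
  have p2 : pbounded vsize (fun w => vsize (vfst (vsnd w))).
    by apply: pb_le Hv _ => v; apply: leq_trans (vsize_fst _) (vsize_snd _).
  have S2 := pb_update 2 S1 p2.
  apply: pexec_seq; first exact: (pexec_assign 1 (EFst (EVar 0)) S0).
  apply: pexec_seq; first exact: (pexec_assign 2 (EFst (ESnd (EVar 0))) S1).
  exact: (pexec_assign 3 (ESnd (ESnd (EVar 0))) S2).
exists (fun w => T1 w + ((vsize w) * (20 + 2 * vsize w + 8 * vsize w + 4 * A w + 2 * K w)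
   + A w)).
  by repeat first [exact: pb_const | assumption | apply: pbD | apply: pbM].
move=> w; have [t1 E1 L1] := H1 w.
set s := update _ 3 _ in E1.
have sz1 := leq_trans (vsize_snd (vsnd w)) (vsize_snd w).
have sz2 := leq_trans (vsize_fst (vsnd w)) (vsize_snd w).
have szc := vsize_fst w.
have [] := @fold_loop_exec F cF (vfst w) (vsize w) (P w) (A w) (K w) _ _
  (vsnd (vsnd w)) s => //.
- move=> x a xw; apply: leq_trans (Hg _ _ _) _; rewrite leq_add2l.
  by rewrite /P; case: (g) => // h; rewrite leq_exp2r //; lia.
- move=> x a xw aA; have [t R L] := HT (Cons (vfst w) (Cons x a)).
  exists t => //; apply: leq_trans L _; apply: leq_trans (Tk _) _.
  by rewrite /K; case: (k) => // h; rewrite leq_exp2r //= ; lia.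
- by rewrite /s /update /= /A; apply: leq_add => //; rewrite leq_mul2r sz1 orbT.
move=> s' [t E [s'2 tL]].
exists (t1 + (t + ecost s' (EVar 2))).
  exists (update s' 0 (eval s' (EVar 2))); last by rewrite /update /= s'2.
  apply: exec_seq E1 _; apply: exec_seq E _; exact: exec_assign.
apply: leq_add => //; apply: leq_add.
  apply: leq_trans tL _; apply: leq_mul => //; lia.
rewrite /= addn0 s'2 /s /update /=.
have : forall l a, vsize l <= vsize w ->
  vsize (foldl (fun a x => F (vfst w) x a) a (vlist l)) <=
  vsize a + vsize l * P w.
  elim=> [n|x _ l IH] a /= lw; first exact: leq_addr.
  apply: leq_trans (IH _ _) _; first by lia.
  have : vsize (F (vfst w) x a) <= vsize a + P w.
    apply: leq_trans (Hg _ _ _) _; rewrite leq_add2l.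
    by rewrite /P; case: (g) => // h; rewrite leq_exp2r //; lia.
  nia.
move/(_ _ (vfst (vsnd w)) sz1)=> H; apply: leq_trans H _.
by apply: leq_add => //; rewrite leq_mul2r sz1 orbT.
Qed.

Lemma enc_seqK : cancel enc_seq vlist.
Proof. by elim=> //= x s ->. Qed.

(** * Arithmetic and list operations as computable functions *)

Definition vadd a b := Num (vnum a + vnum b).
Definition vsub a b := Num (vnum a - vnum b).
Definition vmul a b := Num (vnum a * vnum b).
Definition vdiv a b := Num (vnum a %/ vnum b).
Definition vleq a b := Num (vnum a <= vnum b).
Definition veq a b := Num (vnum a == vnum b).
Definition viscons a := Num (if a is Cons _ _ then 1 else 0).
Definition vif (c a b : value) : value := if truthy c then a else b.
Definition vsum (f : value -> value) l := Num (\sum_(x <- vlist l) vnum (f x)).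
Definition vprod (f : value -> value) l := Num (\prod_(x <- vlist l) vnum (f x)).
Definition vmap (f : value -> value) l := enc_seq [seq f x | x <- vlist l].
Definition vnth l i := nth (Num 0) (vlist l) (vnum i).

Section Combinators.
Variables f g h : value -> value.
Hypotheses (cf : computable f) (cg : computable g) (ch : computable h).

Let pair e := computable_comp (computable_expr e) (computable_cons cf cg).

Lemma computable_num k : computable (fun=> Num k).
Proof. exact: (computable_expr (ENum k)). Qed.

Lemma computable_id : computable (fun v => v).
Proof. exact: (computable_expr (EVar 0)). Qed.

Lemma computable_fst : computable (fun v => vfst (f v)).
Proof. exact: (computable_comp (computable_expr (EFst (EVar 0))) cf). Qed.

Lemma computable_snd : computable (fun v => vsnd (f v)).
Proof. exact: (computable_comp (computable_expr (ESnd (EVar 0))) cf). Qed.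

Lemma computable_iscons : computable (fun v => viscons (f v)).
Proof. exact: (computable_comp (computable_expr (EIsCons (EVar 0))) cf). Qed.

Lemma computable_add : computable (fun v => vadd (f v) (g v)).
Proof. exact: (pair (EAdd (EFst (EVar 0)) (ESnd (EVar 0)))). Qed.

Lemma computable_sub : computable (fun v => vsub (f v) (g v)).
Proof. exact: (pair (ESub (EFst (EVar 0)) (ESnd (EVar 0)))). Qed.

Lemma computable_mul : computable (fun v => vmul (f v) (g v)).
Proof. exact: (pair (EMul (EFst (EVar 0)) (ESnd (EVar 0)))). Qed.

Lemma computable_div : computable (fun v => vdiv (f v) (g v)).
Proof. exact: (pair (EDiv (EFst (EVar 0)) (ESnd (EVar 0)))). Qed.

Lemma computable_leq : computable (fun v => vleq (f v) (g v)).
Proof. exact: (pair (ELeq (EFst (EVar 0)) (ESnd (EVar 0)))). Qed.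

Lemma computable_vif : computable (fun v => vif (f v) (g v) (h v)).
Proof. exact: computable_if. Qed.

Lemma computable_ext f' : f =1 f' -> computable f'.
Proof.
move=> E; case: cf => c [T pT H]; exists c, T => // x.
by rewrite -E; exact: H.
Qed.

End Combinators.

Lemma computable_eq f g :
  computable f -> computable g -> computable (fun v => veq (f v) (g v)).
Proof.
move=> cf cg; apply: (computable_ext
  (computable_mul (computable_leq cf cg) (computable_leq cg cf))) => v.
by rewrite /vmul /veq eqn_leq /=; do 2 case: (_ <= _).
Qed.

Lemma computable_foldl F a l :
  computable (fun w => F (vfst w) (vfst (vsnd w)) (vsnd (vsnd w))) ->
  grows_additively F -> computable a -> computable l ->
  computable (fun v => foldl (fun b x => F v x b) (a v) (vlist (l v))).
Proof.
move=> cF gF ca cl; have cv := computable_id.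
exact: (computable_comp (computable_fold cF gF)
  (computable_cons cv (computable_cons ca cl))).
Qed.

Definition computable2 (f : value -> value -> value) : Prop :=
  computable (fun w => f (vfst w) (vsnd w)).

(** Squaring the base, that is, doubling the exponent, absorbs the cons cell of the pair on which
    the bound for [f] is evaluated. *)
Lemma grows_by F f :
  computable2 f -> (forall c x a, vsize (F c x a) <= vsize a + vsize (f c x)) ->
  grows_additively F.
Proof.
move=> /computable_size[k Hk] H; exists (2 * k) => c x a.
apply: leq_trans (H c x a) _; rewrite leq_add2l.
apply: leq_trans (Hk (Cons c x)) _; rewrite /= expnM.
by case: (k) => // h; rewrite leq_exp2r // -!mulnn; nia.
Qed.

(* A fold step is called on (context, (element, accumulator)). *)
Lemma computable2_state f : computable2 f ->
  computable (fun w => f (vfst w) (vfst (vsnd w))).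
Proof.
move=> cf; have cv := computable_id.
exact: (computable_comp cf (computable_cons (computable_fst cv)
  (computable_fst (computable_snd cv)))).
Qed.

Lemma computable_acc : computable (fun w => vsnd (vsnd w)).
Proof. exact: (computable_snd (computable_snd computable_id)). Qed.

Lemma computable_sum f l : computable2 f -> computable l ->
  computable (fun v => vsum (f v) (l v)).
Proof.
move=> cf cl.
have gF : grows_additively (fun c x a => vadd a (f c x)).
  apply: (grows_by cf) => c x a; apply: leq_trans (vsize_Num_add _ _) _.
  exact: leq_add (vsize_vnum _) (vsize_vnum _).
have cF := computable_add computable_acc (computable2_state cf).
apply: (computable_ext (computable_foldl cF gF (computable_num 0) cl)) => v.
rewrite /vsum; suff H s n : foldl (fun b x => vadd b (f v x)) (Num n) s =
    Num (n + \sum_(x <- s) vnum (f v x)) by rewrite H.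
elim: s n => [|x s IH] n /=; first by rewrite big_nil addn0.
by rewrite IH big_cons addnA.
Qed.

(** Bit lengths add up under multiplication, so a factor independent of the accumulator makes it
    grow additively. *)
Lemma computable_prod f l : computable2 f -> computable l ->
  computable (fun v => vprod (f v) (l v)).
Proof.
move=> cf cl.
have gF : grows_additively (fun c x a => vmul a (f c x)).
  apply: (grows_by cf) => c x a; apply: leq_trans (vsize_Num_mul _ _) _.
  exact: leq_add (vsize_vnum _) (vsize_vnum _).
have cF := computable_mul computable_acc (computable2_state cf).
apply: (computable_ext (computable_foldl cF gF (computable_num 1) cl)) => v.
rewrite /vprod; suff H s n : foldl (fun b x => vmul b (f v x)) (Num n) s =
    Num (n * \prod_(x <- s) vnum (f v x)) by rewrite H mul1n.
elim: s n => [|x s IH] n /=; first by rewrite big_nil muln1.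
by rewrite IH big_cons mulnA.
Qed.

Lemma grows_cons f : computable2 f ->
  grows_additively (fun c x a => Cons (f c x) a).
Proof.
move=> cf; apply: (grows_by (f := fun c x => Cons (f c x) (Num 0))).
  exact: computable_cons cf (computable_num 0).
by move=> c x a /=; rewrite trunc_log0; lia.
Qed.

Lemma foldl_cons_enc (f : value -> value) s :
  foldl (fun b x => Cons (f x) b) (Num 0) s = enc_seq (rev [seq f x | x <- s]).
Proof.
rewrite /rev -[Num 0]/(enc_seq [::]); elim: s [::] => //= x s IH a.
by rewrite -IH.
Qed.

Lemma computable_rev l : computable l ->
  computable (fun v => enc_seq (rev (vlist (l v)))).
Proof.
move=> cl; have cf : computable2 (fun _ x => x) by exact: computable_snd computable_id.
have cF := computable_cons (computable2_state cf) computable_acc.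
apply: (computable_ext (computable_foldl cF (grows_cons cf) (computable_num 0) cl)).
by move=> v; rewrite foldl_cons_enc map_id.
Qed.

(** Consing onto the accumulator reverses the order, hence the fold over the reversed list. *)
Lemma computable_map f l : computable2 f -> computable l ->
  computable (fun v => vmap (f v) (l v)).
Proof.
move=> cf cl; have cF := computable_cons (computable2_state cf) computable_acc.
apply: (computable_ext (computable_foldl cF (grows_cons cf) (computable_num 0)
  (computable_rev cl))).
by move=> v; rewrite enc_seqK foldl_cons_enc map_rev revK.
Qed.

(* The accumulator pairs the position with the element found so far. *)
Lemma computable_nth l i : computable l -> computable i ->
  computable (fun v => vnth (l v) (i v)).
Proof.
move=> cl ci.
pose F c x a := Cons (vadd (vfst a) (Num 1))
  (vif (veq (vfst a) c) x (vsnd a)).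
have cv := computable_id; have c1 := computable_fst cv.
have c2 := computable_fst (computable_snd cv); have c3 := computable_acc.
have cF : computable (fun w => F (vfst w) (vfst (vsnd w)) (vsnd (vsnd w))).
  apply: computable_cons.
    by apply: computable_add (computable_num 1); exact: computable_fst.
  apply: computable_vif => //; last exact: computable_snd.
  by apply: computable_eq => //; exact: computable_fst.
have gF : grows_additively F.
  (* The counter gains at most one unit of size and the stored element is kept or replaced by [x];
     the padding after [x] covers this, also for an accumulator that is not a pair. *)
  apply: (grows_by (f := fun _ x => Cons x (Cons (Num 0) (Num 0)))).
    have c0 := computable_num 0; have cv' := computable_snd cv.
    exact: (computable_cons cv' (computable_cons c0 c0)).
  move=> c x a; rewrite /F [vsize (Cons _ _)]/=.
  have := vsize_Num_add (vnum (vfst a)) 1; rewrite /= => H.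
  have : vsize (vif (veq (vfst a) c) x (vsnd a)) <= vsize x + vsize (vsnd a).
    by rewrite /vif; case: truthy; lia.
  case: a H => [k|a b] /=; rewrite !trunc_log0; first by rewrite !trunc_log1; lia.
  by have := vsize_vnum a; rewrite /= trunc_log1; lia.
have cG := computable_comp (computable_fold cF gF) (computable_cons ci
  (computable_cons (computable_num 0) cl)).
apply: (computable_ext (computable_snd cG)) => v /=.
rewrite /vnth; set k := i v; move: (vlist (l v)) => s {cG}.
(* Generalized to any starting position: if the wanted position is not among those still to be
   scanned, the stored value survives. *)
suff H a : vsnd (foldl (fun a x => F k x a) a s) =
    if vnum (vfst a) <= vnum k < vnum (vfst a) + size s
    then nth (Num 0) s (vnum k - vnum (vfst a)) else vsnd a.
  by rewrite H /= subn0 add0n; case: ltnP => // ?; rewrite nth_default.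
elim: s a => [|x s IH] a; first by rewrite /= addn0; case: ifP => //; lia.
rewrite [foldl _ _ _]/= IH /= /vif /=; set n := vnum (vfst a).
have [<-|nk] := eqVneq n (vnum k).
  by rewrite subnn leqnn addn1 ltnn /=; case: ifP => //; lia.
rewrite addn1 addSnnS; case: ifP => H; case: ifP => H' //=; try lia.
by have -> : vnum k - n = (vnum k - n.+1).+1 by lia.
Qed.

(** Counting downwards lets consing produce an increasing list; on an empty accumulator the count
    starts from [c]. *)
Definition viota_step (c _ a : value) : value :=
  Cons (vsub c (vadd (vsub c (vif (viscons a) (vfst a) c)) (Num 1))) a.

(* [c - ((c - k) + 1)] is [k - 1] for [0 < k <= c], and its size is bounded by
   that of [c] even outside this range. *)
Lemma computable_iota_aux a l c : computable a -> computable l -> computable c ->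
  computable (fun v =>
    foldl (fun b x => viota_step (c v) x b) (a v) (vlist (l v))).
Proof.
move=> ca cl cc; have cv := computable_id.
have gF : grows_additively viota_step.
  apply: (grows_by (f := fun c _ => Cons c (Num 0))).
    by apply: computable_cons (computable_num 0); exact: computable_fst.
  move=> c' x b; rewrite /viota_step [vsize (Cons _ _)]/= [vsize (Cons c' _)]/=.
  have : vsize (vsub c' (vadd (vsub c' (vif (viscons b) (vfst b) c')) (Num 1)))
    <= vsize c'.
    by apply: leq_trans (vsize_vnum c'); exact/vsize_Num_mono/leq_subr.
  by rewrite [_ (vsub _ _)]/= trunc_log0; lia.
have c1 := computable_fst cv; have c3 := computable_acc.
have cF : computable (fun w =>
    viota_step (vfst w) (vfst (vsnd w)) (vsnd (vsnd w))).
  apply: computable_cons => //; apply: computable_sub => //.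
  apply: computable_add (computable_num 1); apply: computable_sub => //.
  by apply: computable_vif => //; [exact: computable_iscons|exact: computable_fst].
exact: (computable_comp (computable_fold cF gF)
  (computable_cons cc (computable_cons ca cl))).
Qed.

Lemma foldl_iota m k s : k + size s <= m ->
  foldl (fun b x => viota_step (Num m) x b)
    (enc_seq [seq Num i | i <- iota (m - k) k]) s =
  enc_seq [seq Num i | i <- iota (m - (k + size s)) (k + size s)].
Proof.
elim: s k => [|x s IH] k /= km; first by rewrite addn0.
rewrite addnS -addSn -IH; last by rewrite addSn -addnS.
congr foldl; have -> : m - k = (m - k.+1).+1 by lia.
rewrite /viota_step /=; congr (Cons _ _).
(* For [k = 0] the accumulator is empty and its missing head is replaced by [m]. *)
by case: k km => [|k] km; congr Num; rewrite /=; lia.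
Qed.

(* The loop is driven by the rows since the number of vertices is given in
   binary. *)
Definition vidx (rows n : value) : value :=
  foldl (fun b x => viota_step (vadd n n) x b)
    (foldl (fun b x => viota_step (vadd n n) x b) (Num 0) (vlist rows))
    (vlist rows).

Lemma computable_idx rows n : computable rows -> computable n ->
  computable (fun v => vidx (rows v) (n v)).
Proof.
move=> cr cn; have c2 := computable_add cn cn.
apply: computable_iota_aux => //; apply: computable_iota_aux => //.
exact: computable_num.
Qed.

Lemma vlist_idx rows n : size (vlist rows) = n ->
  vlist (vidx rows (Num n)) = [seq Num i | i <- iota 0 (2 * n)].
Proof.
move=> sz; rewrite /vidx /vadd [vnum _]/= addnn -mul2n.
rewrite (@foldl_iota (2 * n) 0); last by rewrite sz; lia.
rewrite sz add0n (@foldl_iota (2 * n) n); last by rewrite sz; lia.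
rewrite enc_seqK sz; congr (map _ (iota _ _)); lia.
Qed.

(** * The reduction as a program *)

Definition vget rows i j := vnth (vnth rows i) j.

Definition phi_num v := vfst (vfst v).
Definition phi_den v := vsnd (vfst v).
Definition num_vertices v := vfst (vfst (vsnd v)).
Definition cap_rows v := vsnd (vfst (vsnd v)).
Definition dem_rows v := vsnd (vsnd (vsnd v)).

Definition entry_den e := vif (viscons e) (vsnd e) (Num 1).

(** A product instead of a least common multiple: it is a plain fold and still has polynomial
    size. *)
Definition common_den v :=
  vmul (vprod (fun r => vprod (fun e => entry_den e) r) (cap_rows v))
       (vprod (fun r => vprod (fun e => entry_den e) r) (dem_rows v)).

(** The factor [f] is the denominator of phi0 for capacities and its numerator for demands. Up to
    one common factor, capacities are kept and demands multiplied by phi0. *)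
Definition scaled v f e :=
  vmul (vmul (vfst e) (vdiv (common_den v) (vsnd e))) f.

Definition total_entries v f rows :=
  vsum (fun r => vsum (fun e => scaled v f e) r) rows.

Definition penalty v :=
  vmul (vadd (total_entries v (phi_den v) (cap_rows v)) (Num 1))
       (vadd (total_entries v (phi_num v) (dem_rows v)) (Num 1)).

Definition in_left v i := vleq (vadd i (Num 1)) (num_vertices v).
Definition base_idx v i := vif (in_left v i) i (vsub i (num_vertices v)).

(** An integer over 1 is in lowest terms, as the encoding of rational weights requires. *)
Definition scaled_entry v f e :=
  vif (viscons e) (Cons (scaled v f e) (Num 1)) (Num 0).

Definition entry v i j :=
  vif (veq (in_left v i) (in_left v j))
    (scaled_entry v (phi_num v) (vget (dem_rows v) (base_idx v i) (base_idx v j)))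
    (vif (veq (base_idx v i) (base_idx v j))
      (Cons (penalty v) (Num 1))
      (scaled_entry v (phi_den v)
        (vget (cap_rows v) (base_idx v i) (base_idx v j)))).

Definition vertices v := vidx (cap_rows v) (num_vertices v).

Definition reduction v :=
  Cons (vadd (num_vertices v) (num_vertices v))
    (vmap (fun i => vmap (fun j => entry v i j) (vertices v)) (vertices v)).

Definition left_side v := vmap (fun i => in_left v i) (vertices v).

(** Ordered pairs count every edge twice, which is harmless since such sums are only compared with
    each other. *)
Definition weight v s :=
  vsum (fun i => vsum (fun j =>
    vif (veq (vnth s i) (vnth s j)) (Num 0) (vfst (entry v i j)))
    (vertices v)) (vertices v).

(** The argument pairs the instance with the answer on the doubled graph; [enc_bot] is a number and
    [enc_cut] a pair. Bottom yields 1, since above the gap a cut must be returned. *)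
Definition decision w :=
  vif (viscons (vsnd w))
    (vsub (Num 1)
      (vleq (weight (vfst w) (vsnd (vsnd w))) (weight (vfst w) (left_side (vfst w)))))
    (Num 1).

Ltac computability :=
  repeat first [assumption | lazymatch goal with
  | |- computable2 _ => rewrite /computable2
  | |- computable (fun v => v) => exact: computable_id
  | |- computable (fun v => Num _) => exact: computable_num
  | |- computable (fun v => Cons (@?f v) (@?g v)) => apply: (@computable_cons f g)
  | |- computable (fun v => vfst (@?f v)) => apply: (@computable_fst f)
  | |- computable (fun v => vsnd (@?f v)) => apply: (@computable_snd f)
  | |- computable (fun v => viscons (@?f v)) => apply: (@computable_iscons f)
  | |- computable (fun v => vadd (@?f v) (@?g v)) => apply: (@computable_add f g)
  | |- computable (fun v => vsub (@?f v) (@?g v)) => apply: (@computable_sub f g)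
  | |- computable (fun v => vmul (@?f v) (@?g v)) => apply: (@computable_mul f g)
  | |- computable (fun v => vdiv (@?f v) (@?g v)) => apply: (@computable_div f g)
  | |- computable (fun v => vleq (@?f v) (@?g v)) => apply: (@computable_leq f g)
  | |- computable (fun v => veq (@?f v) (@?g v)) => apply: (@computable_eq f g)
  | |- computable (fun v => vnth (@?f v) (@?g v)) => apply: (@computable_nth f g)
  | |- computable (fun v => vidx (@?f v) (@?g v)) => apply: (@computable_idx f g)
  | |- computable (fun v => vif (@?f v) (@?g v) (@?h v)) =>
      apply: (@computable_vif f g h)
  | |- computable (fun v => vsum (@?f v) (@?l v)) => apply: (@computable_sum f l)
  | |- computable (fun v => vprod (@?f v) (@?l v)) => apply: (@computable_prod f l)
  | |- computable (fun v => vmap (@?f v) (@?l v)) => apply: (@computable_map f l)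
  end].

Lemma computable_reduction : computable reduction.
Proof.
rewrite /reduction /vertices /entry /penalty /total_entries /scaled_entry /scaled
  /common_den /entry_den /base_idx /in_left /vget /num_vertices /phi_num /phi_den
  /cap_rows /dem_rows.
by computability.
Qed.

Lemma computable_decision : computable decision.
Proof.
rewrite /decision /weight /left_side /vertices /entry /penalty /total_entries
  /scaled_entry /scaled /common_den /entry_den /base_idx /in_left /vget /num_vertices
  /phi_num /phi_den /cap_rows /dem_rows.
by computability.
Qed.

(** * Polynomial bounds and running an algorithm as a subroutine *)

Lemma pb_horner (p : {poly nat}) : pbounded id (fun n => p.[n]%R).
Proof.
elim/poly_ind: p => [|p c IH].
  by apply: pb_le (pb_const id 0) _ => n; rewrite horner0.
apply: pb_le (pbD (pbM IH (pb_measure id)) (pb_const id c)) _ => n.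
by rewrite hornerMXaddC.
Qed.

Lemma pb_polynomial (X : Type) (m b : X -> nat) :
  pbounded m b -> exists p : {poly nat}, forall x, b x <= p.[m x]%R.
Proof.
move=> [k Hk]; exists (('X + 2%:P) ^+ k)%R => x; apply: leq_trans (Hk x) _.
rewrite horner_exp hornerD hornerX hornerC.
by rewrite -[(_ + _)%R]/(m x + 2) addn2 natrXE.
Qed.

Lemma runs_det c v w1 t1 w2 t2 :
  runs c v w1 t1 -> runs c v w2 t2 -> w1 = w2 /\ t1 = t2.
Proof.
by move=> [s1 E1 <-] [s2 E2 <-]; have [-> ->] := exec_det E1 E2.
Qed.

Section Reduction.
Variables (X Y : Type) (encX : X -> value) (encY : Y -> value) (F : Y -> X).
Variables (A : program) (r d : value -> value).
Hypotheses (cr : computable r) (cd : computable d).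
Hypothesis rE : forall y, r (encY y) = encX (F y).

(* Pairing each input with its answer makes the answer a function, without
   choice. *)
Let oracle : Type := {yw : Y * value | outputs A (encX (F yw.1)) yw.2}.
Let input (x : oracle) := encY (sval x).1.
Let answer (x : oracle) := (sval x).2.

Lemma polytime_reduction : polytime encX A ->
  exists B, polytime encY B /\ forall y w, outputs B (encY y) w ->
    exists2 w', outputs A (encX (F y)) w' & w = d (Cons (encY y) w').
Proof.
move=> [p Hp]; have [cR HR] := cr; have [cD HD] := cd.
pose m x := vsize (input x).
have Hm : pbounded m (fun x => vsize (input x)) := pb_measure m.
have HR' := computes_comp HR Hm.
have pr := computes_size HR' Hm.
have HA : computes m A (fun x => r (input x)) answer.
  exists (fun x => p.[vsize (r (input x))]%R).
    exact: (pb_comp (pb_horner p) pr).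
  (* By determinism, the answer carried by the index is the one that [A] produces within its
     polynomial bound. *)
  move=> [[y w] /= [t0 R0]]; have [w' [t R tp]] := Hp (F y).
  rewrite /input /answer /= rE; exists t => //.
  by have [<- _] := runs_det R R0.
have HD' := computes_comp (h := fun x => Cons (input x) (answer x)) HD
  (pbS (pbD Hm (computes_size HA pr))).
pose B := Seq (Call 1 cR (EVar 0)) (Seq (Call 2 A (EVar 1))
  (Call 0 cD (ECons (EVar 0) (EVar 2)))).
have [T pT HB] : computes m B input (fun x => d (Cons (input x) (answer x))).
  have S0 := pb_init Hm.
  have S1 := pb_update 1 S0 pr.
  have S2 := pb_update 2 S1 (computes_size HA pr).
  apply: computes_exec; first apply: pexec_seq.
  - exact: (pexec_call _ (g := fun x => r (input x))).
  - apply: pexec_seq; first exact: (pexec_call _ (g := answer)).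
    exact: (pexec_call (e := ECons (EVar 0) (EVar 2)) 0 S2 HD').
  - by [].
exists B; have HBy y : exists w, outputs A (encX (F y)) w.
  by have [w [t R _]] := Hp (F y); exists w, t.
split.
  (* The measure of an index depends on [y] alone, so any answer paired with [y] gives the bound for
     [y]. *)
  have [q Hq] := pb_polynomial pT; exists q => y; have [w Hw] := HBy y.
  have [t R L] := HB (exist _ (y, w) Hw); eexists; exists t; first exact: R.
  exact: leq_trans L (Hq _).
move=> y w [t R]; have [w' Hw] := HBy y; exists w' => //.
have [t' R' _] := HB (exist _ (y, w') Hw).
by have [] := runs_det R R'.
Qed.

End Reduction.

(** * The doubled graph *)

Definition separated (m : nat) (S : {set 'I_m}) (x y : 'I_m) : bool :=
  (x \in S) != (y \in S).

(* Sums over ordered pairs count every edge twice. *)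
Lemma total_wt_double (m : nat) (G : wgraph m) (P : rel 'I_m) (w : 'I_m -> 'I_m -> rat) :
  symmetric P -> (forall x y, w x y = if adj G x y then wt G x y else 0%R) ->
  (total_wt G [set p : 'I_m * 'I_m | [&& (p.1 < p.2)%N, adj G p.1 p.2 & P p.1 p.2]] *+ 2 =
   \sum_x \sum_y if P x y then w x y else 0)%R.
Proof.
move=> symP wE; rewrite /total_wt pair_bigA /= -big_mkcond /=.
rewrite (eq_bigr (fun p : 'I_m * 'I_m => w p.1 p.2)); last first.
  by move=> p; rewrite inE wE => /and3P[_ -> _].
pose Q (p : 'I_m * 'I_m) := P p.1 p.2 && adj G p.1 p.2.
have -> : (\sum_(p : 'I_m * 'I_m | P p.1 p.2) w p.1 p.2 = \sum_(p | Q p) w p.1 p.2)%R.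
  rewrite [RHS]big_mkcondr; apply: eq_bigr => p _.
  by rewrite wE; case: ifP.
rewrite [RHS](bigID (fun p : 'I_m * 'I_m => p.1 < p.2)) mulr2n /=; congr (_ + _)%R.
  by apply: eq_bigl => p; rewrite inE /Q andbC [adj _ _ _ && _]andbC.
(* Swapping the components turns the remaining pairs into increasing ones; the diagonal drops out by
   irreflexivity. *)
rewrite [RHS](reindex_inj (h := fun p : 'I_m * 'I_m => (p.2, p.1))) /=; last first.
  by move=> [a b] [c d] [-> ->].
apply: eq_big => [p|p _]; last by rewrite !wE adj_sym wt_sym.
rewrite inE /Q /= symP adj_sym -leqNgt [p.1 <= _]leq_eqVlt.
case: eqVneq => [/ord_inj E|_] /=; first by rewrite E adj_irr ltnn andbF.
by rewrite [RHS]andbC [adj _ _ _ && _]andbC.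
Qed.

Lemma double_lt (m : nat) (b : bool) (u : 'I_m) :
  (if b then u : nat else m + u) < 2 * m.
Proof.
move: (ltn_ord u); rewrite mul2n -addnn.
by case: b; [exact: ltn_addr|rewrite ltn_add2l].
Qed.

Lemma base_lt (m : nat) (x : 'I_(2 * m)) : (if x < m then x : nat else x - m) < m.
Proof. by have := ltn_ord x; case: (ltnP x m); lia. Qed.

Section Doubling.
Variables (n : nat).
Implicit Types (u v : 'I_n) (x y : 'I_(2 * n)) (b : bool).

(** [copy], [side] and [base] identify the vertices with pairs of a boolean and an original vertex;
    [true] is the left copy, with the indices below [n]. *)
Definition copy b u : 'I_(2 * n) := Ordinal (double_lt b u).
Definition side x : bool := x < n.
Definition base x : 'I_n := Ordinal (base_lt x).

Lemma side_copy b u : side (copy b u) = b.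
Proof. by case: b; rewrite /side /= ?ltn_ord // ltnNge leq_addr. Qed.

Lemma base_copy b u : base (copy b u) = u.
Proof.
apply: val_inj => /=; case: b; first by rewrite ltn_ord.
by rewrite ltnNge leq_addr /= addKn.
Qed.

Lemma copy_base x : copy (side x) (base x) = x.
Proof.
by apply: val_inj; rewrite /= /side; case: ltnP => // ?; rewrite subnKC.
Qed.

Lemma sum_copies (F : 'I_(2 * n) -> nat) :
  \sum_x F x = \sum_u (F (copy true u) + F (copy false u)).
Proof.
rewrite (reindex (fun p : 'I_n * bool => copy p.2 p.1)) /=; last first.
  exists (fun x => (base x, side x)) => [[u b] _|x _] /=.
    by rewrite base_copy side_copy.
  exact: copy_base.
rewrite -(pair_bigA _ (fun u b => F (copy b u))) /=.
by apply: eq_bigr => u _; rewrite big_bool.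
Qed.

Variables (ac ad : rel 'I_n) (cw dw : 'I_n -> 'I_n -> nat) (M : nat).
Hypotheses (ac_sym : symmetric ac) (ad_sym : symmetric ad).
Hypothesis ad_irr : irreflexive ad.
Hypotheses (cw_sym : forall u v, cw u v = cw v u).
Hypotheses (dw_sym : forall u v, dw u v = dw v u).
Hypotheses (cw0 : forall u v, ~~ ac u v -> cw u v = 0).
Hypotheses (dw0 : forall u v, ~~ ad u v -> dw u v = 0).

Definition doubled_adj x y : bool :=
  if side x == side y then ad (base x) (base y)
  else (base x == base y) || ac (base x) (base y).

Definition doubled_wt x y : nat :=
  if side x == side y then dw (base x) (base y)
  else if base x == base y then M else cw (base x) (base y).

Lemma doubled_adj_sym : symmetric doubled_adj.
Proof.
move=> x y; rewrite /doubled_adj eq_sym ad_sym ac_sym.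
by rewrite [base x == _]eq_sym.
Qed.

Lemma doubled_adj_irr : irreflexive doubled_adj.
Proof. by move=> x; rewrite /doubled_adj eqxx. Qed.

Lemma doubled_wt_sym x y : doubled_wt x y = doubled_wt y x.
Proof.
rewrite /doubled_wt eq_sym dw_sym cw_sym.
by rewrite [base x == _]eq_sym.
Qed.

Definition doubled : wgraph (2 * n) :=
  WGraph doubled_adj_sym doubled_adj_irr
    (fun x y => congr1 (fun k => k%:R%R : rat) (doubled_wt_sym x y)).

Definition left_copy : {set 'I_(2 * n)} := [set x | side x].

Definition pair_weight (P : rel 'I_(2 * n)) : nat :=
  \sum_x \sum_y if P x y then doubled_wt x y else 0.

Lemma doubled_wt0 x y : ~~ doubled_adj x y -> doubled_wt x y = 0.
Proof.
rewrite /doubled_adj /doubled_wt; case: eqP => _; first by move/dw0 ->.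
by rewrite negb_or; case: eqP => //= _ /cw0 ->.
Qed.

Lemma doubled_total P : symmetric P ->
  (total_wt doubled [set p : 'I_(2 * n) * 'I_(2 * n) |
      [&& (p.1 < p.2)%N, adj doubled p.1 p.2 & P p.1 p.2]] *+ 2
   = (pair_weight P)%:R)%R.
Proof.
move=> symP; rewrite (total_wt_double (w := fun x y => (doubled_wt x y)%:R%R)) //.
  rewrite natr_sum; apply: eq_bigr => x _; rewrite natr_sum.
  by apply: eq_bigr => y _; case: ifP.
by move=> x y; case: ifPn => //= /doubled_wt0 ->.
Qed.

Lemma separated_sym m (S : {set 'I_m}) : symmetric (separated S).
Proof. by move=> x y; rewrite /separated eq_sym. Qed.

Lemma doubled_cut S :
  (cut_wt doubled S *+ 2 = (pair_weight (separated S))%:R)%R.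
Proof. by rewrite -doubled_total //; exact: separated_sym. Qed.

Definition only_cut_by (S T : {set 'I_(2 * n)}) : rel 'I_(2 * n) :=
  fun x y => separated S x y && ~~ separated T x y.

Lemma doubled_diff S T :
  (total_wt doubled (cut_edges doubled S :\: cut_edges doubled T) *+ 2 =
   (pair_weight (only_cut_by S T))%:R)%R.
Proof.
rewrite -doubled_total; last first.
  by move=> x y; rewrite /only_cut_by !(separated_sym _ x).
congr (total_wt _ _ *+ 2)%R; apply/setP => p; rewrite !inE /only_cut_by /separated.
by case: (p.1 < p.2); case: (adj _ _ _); do 2 case: ((p.1 \in _) != _).
Qed.

(** Both sides are the weight of the union of the two cuts. Comparing two cuts thus amounts to
    comparing what is gained with what is lost. *)
Lemma pair_weight_exchange S T :
  pair_weight (separated T) + pair_weight (only_cut_by S T) =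
  pair_weight (separated S) + pair_weight (only_cut_by T S).
Proof.
rewrite /pair_weight -!big_split; apply: eq_bigr => x _.
rewrite -!big_split; apply: eq_bigr => y _ /=; rewrite /only_cut_by.
by do 2 case: (separated _ x y); rewrite /= ?addn0.
Qed.

Lemma pair_weight_copies P : pair_weight P =
  \sum_u \sum_v
    (((if P (copy true u) (copy true v) then dw u v else 0) +
      (if P (copy true u) (copy false v) then if u == v then M else cw u v else 0)) +
     ((if P (copy false u) (copy true v) then if u == v then M else cw u v else 0) +
      (if P (copy false u) (copy false v) then dw u v else 0))).
Proof.
rewrite /pair_weight sum_copies; apply: eq_bigr => u _.
rewrite !sum_copies -big_split; apply: eq_bigr => v _ /=.
by rewrite /doubled_wt !side_copy !base_copy /=.
Qed.

(** * Gain and loss relative to the cut between the copies *)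

Definition cut2 (w : 'I_n -> 'I_n -> nat) (A : {set 'I_n}) : nat :=
  \sum_u \sum_v if separated A u v then w u v else 0.

Definition splits_pairs (T : {set 'I_(2 * n)}) : bool :=
  [forall u, separated T (copy true u) (copy false u)].

Definition trace (T : {set 'I_(2 * n)}) : {set 'I_n} := [set u | copy true u \in T].

Lemma mem_copy_left b u : (copy b u \in left_copy) = b.
Proof. by rewrite inE side_copy. Qed.

(** Such a [T] consists of the left copies of its trace and the right copies of the complement, so
    the trace determines it. *)
Lemma splits_mem T : splits_pairs T ->
  forall b u, (copy b u \in T) = (b == (u \in trace T)).
Proof.
move=> /forallP HT b u; have := HT u; rewrite /separated inE.
by case: b; case: (copy true u \in T); case: (copy false u \in T).
Qed.

(** An edge not cut by [left_copy] lies inside one copy, so it is a demand edge, cut by [T] exactly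
    when the trace separates its ends; the two copies give the factor 2. *)
Lemma gain_split T : splits_pairs T ->
  pair_weight (only_cut_by T left_copy) = 2 * cut2 dw (trace T).
Proof.
move=> /splits_mem HT; rewrite pair_weight_copies /cut2 big_distrr.
apply: eq_bigr => u _; rewrite big_distrr; apply: eq_bigr => v _ /=.
rewrite /only_cut_by /separated !HT !mem_copy_left !eqxx /= !andbT !andbF.
by do 2 case: (_ \in trace T) => //=; rewrite !addn0 ?add0n ?mul2n ?addnn.
Qed.

(** An edge between the copies is missed by [T] exactly when the trace separates the base vertices
    of its ends. The edges of weight [M] join copies of one vertex, so none of them is lost. *)
Lemma loss_split T : splits_pairs T ->
  pair_weight (only_cut_by left_copy T) = 2 * cut2 cw (trace T).
Proof.
move=> /splits_mem HT; rewrite pair_weight_copies /cut2 big_distrr.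
apply: eq_bigr => u _; rewrite big_distrr; apply: eq_bigr => v _ /=.
rewrite /only_cut_by /separated !HT !mem_copy_left !eqxx /= add0n addn0.
case: (eqVneq u v) => [->|_]; first by case: (v \in _).
by do 2 case: (_ \in trace T) => //=; rewrite ?mul2n ?addnn.
Qed.

Definition pair_total (w : 'I_n -> 'I_n -> nat) : nat := \sum_u \sum_v w u v.

Lemma cut2_le_total w A : cut2 w A <= pair_total w.
Proof. by apply: leq_sum => u _; apply: leq_sum => v _; case: ifP. Qed.

Lemma gain_le T :
  pair_weight (only_cut_by T left_copy) <= 2 * pair_total dw.
Proof.
rewrite pair_weight_copies /pair_total big_distrr; apply: leq_sum => u _.
rewrite big_distrr; apply: leq_sum => v _ /=.
rewrite /only_cut_by /separated !mem_copy_left /= !andbF addn0 add0n.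
rewrite [2 * dw u v]mul2n -addnn.
by apply: leq_add; case: ifP.
Qed.

(** One unseparated pair of copies suffices; both of its orders count. *)
Lemma loss_ge T : ~~ splits_pairs T ->
  2 * M <= pair_weight (only_cut_by left_copy T).
Proof.
rewrite negb_forall => /existsP[u Hu].
have P1 : only_cut_by left_copy T (copy true u) (copy false u).
  by rewrite /only_cut_by Hu andbT /separated !mem_copy_left.
have P2 : only_cut_by left_copy T (copy false u) (copy true u).
  by rewrite /only_cut_by [separated T _ _]separated_sym Hu /separated !mem_copy_left.
rewrite pair_weight_copies (bigD1 u) //; apply: leq_trans (leq_addr _ _).
rewrite (bigD1 u) //; apply: leq_trans (leq_addr _ _).
by rewrite P1 P2 eqxx; lia.
Qed.

Definition lift_cut (A : {set 'I_n}) : {set 'I_(2 * n)} :=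
  [set x | side x == (base x \in A)].

Lemma splits_lift A : splits_pairs (lift_cut A).
Proof.
by apply/forallP => u; rewrite /separated !inE !side_copy !base_copy; case: (u \in A).
Qed.

Lemma trace_lift A : trace (lift_cut A) = A.
Proof. by apply/setP => u; rewrite !inE side_copy base_copy; case: (u \in A). Qed.

Lemma splits_eq S T : splits_pairs S -> splits_pairs T ->
  trace S = trace T -> S = T.
Proof.
move=> /splits_mem HS /splits_mem HT E; apply/setP => x.
by rewrite -(copy_base x) HS HT E.
Qed.

(** By the exchange identity, [T] is no heavier exactly when its gain is at most its loss. For a [T]
    splitting all pairs this is a comparison at its trace; otherwise the loss of at least [2 * M]
    covers every possible gain. *)
Lemma left_maxP : pair_total dw <= M ->
  is_max_cut doubled left_copy <-> forall A, cut2 dw A <= cut2 cw A.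
Proof.
move=> dM.
have E T : (cut_wt doubled T <= cut_wt doubled left_copy)%R =
  (pair_weight (only_cut_by T left_copy) <= pair_weight (only_cut_by left_copy T)).
  rewrite -(@ler_pMn2r _ 2) // !doubled_cut ler_nat.
  by have := pair_weight_exchange left_copy T; lia.
split=> [H A|H T]; last first.
  rewrite E; case: (boolP (splits_pairs T)) => [HT|/loss_ge HT].
    by rewrite gain_split // loss_split // leq_mul2l H.
  by apply: leq_trans (gain_le T) (leq_trans _ HT); rewrite leq_mul2l dM.
have := H (lift_cut A).
by rewrite E gain_split ?loss_split ?trace_lift ?leq_mul2l //; exact: splits_lift.
Qed.

Lemma left_stable (R : realType) (gamma : R) :
  is_max_cut doubled left_copy ->
  (forall A, A != set0 -> A != setT ->
    gamma * (cut2 dw A)%:R < (cut2 cw A)%:R :> R)%R ->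
  (gamma * (pair_total dw)%:R < M%:R :> R)%R -> 0 < M ->
  stable gamma doubled.
Proof.
move=> mx HA HM M0; exists left_copy => // T TL TR.
rewrite -(@ltr_pMn2r _ 2) // -mulrnAr -!raddfMn /= !doubled_diff !ratr_nat.
have two : (0 < 2%:R :> R)%R by rewrite ltr0n.
case: (boolP (splits_pairs T)) => [HT|HT].
  rewrite gain_split // loss_split // !natrM mulrCA ltr_pM2l //; apply: HA.
    (* Among cuts splitting all pairs, the trace is empty only for the complement of [left_copy] and
       full only for [left_copy] itself. *)
    apply/eqP => E; apply: TR; apply: splits_eq => //.
      by apply/forallP => u; rewrite /separated !inE !side_copy.
    by rewrite E; apply/setP => u; rewrite !inE side_copy.
  apply/eqP => E; apply: TL; apply: splits_eq => //.
    by apply/forallP => u; rewrite /separated !inE !side_copy.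
  by rewrite E; apply/setP => u; rewrite !inE side_copy.
apply: (@lt_le_trans _ _ (2 * M)%:R%R); last by rewrite ler_nat loss_ge.
(* The bound on the gain can be multiplied by [gamma] only if [gamma] is positive; otherwise the
   positive loss is enough. *)
have [g0|g0] := leP gamma 0%R.
  apply: (@le_lt_trans _ _ 0%R); last by rewrite ltr0n muln_gt0.
  by rewrite mulr_le0_ge0 // ler0n.
apply: (@le_lt_trans _ _ (gamma * (2 * pair_total dw)%:R)%R).
  by rewrite ler_pM2l // ler_nat gain_le.
by rewrite !natrM mulrCA ltr_pM2l.
Qed.

End Doubling.

(** * Correctness of the reduction *)

Definition edge_den (m : nat) (G : wgraph m) (u v : 'I_m) : nat :=
  if adj G u v then `|denq (wt G u v)|%N else 1.

Definition scaled_wt (m : nat) (G : wgraph m) (k f : nat) (u v : 'I_m) : nat :=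
  if adj G u v
  then `|numq (wt G u v)| * (k %/ `|denq (wt G u v)|) * f else 0.

Lemma edge_den_gt0 (m : nat) (G : wgraph m) u v : 0 < edge_den G u v.
Proof. by rewrite /edge_den; case: ifP => // _; rewrite absz_gt0 denq_neq0. Qed.

Lemma scaled_wt_sym (m : nat) (G : wgraph m) k f u v :
  scaled_wt G k f u v = scaled_wt G k f v u.
Proof. by rewrite /scaled_wt adj_sym wt_sym. Qed.

Lemma scaled_wt0 (m : nat) (G : wgraph m) k f u v :
  ~~ adj G u v -> scaled_wt G k f u v = 0.
Proof. by rewrite /scaled_wt => /negbTE ->. Qed.

Section Scaling.
Variables (m : nat) (G : wgraph m) (k f : nat).
Hypotheses (k_gt0 : 0 < k) (f_gt0 : 0 < f).
Hypothesis dvd_k : forall u v, edge_den G u v %| k.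
Hypothesis wt_gt0 : forall u v, adj G u v -> (0 < wt G u v)%R.

Lemma pos_ratE (q : rat) : (0 < q)%R -> (q * `|denq q|%N%:R = `|numq q|%N%:R)%R.
Proof.
move=> q0; rewrite !natr_absz !ger0_norm ?denq_ge0 ?numq_ge0 ?ltW //.
by rewrite -{1}(divq_num_den q) divfK // intr_eq0 denq_neq0.
Qed.

Lemma scaled_wtE u v : 
  ((scaled_wt G k f u v)%:R =
   (if adj G u v then wt G u v else 0) * (k%:R * f%:R) :> rat)%R.
Proof.
have := dvd_k u v; rewrite /scaled_wt /edge_den; case: ifP => a; last by rewrite mul0r.
by move=> dv; rewrite !natrM -(pos_ratE (wt_gt0 a)) -[in RHS](divnK dv) natrM; ring.
Qed.

Lemma scaled_wt_gt0 u v : adj G u v -> 0 < scaled_wt G k f u v.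
Proof.
move=> a; rewrite -(@ltr_nat rat) scaled_wtE a mulr_gt0 ?wt_gt0 //.
by rewrite mulr_gt0 // ltr0n.
Qed.

Lemma scaled_cut (A : {set 'I_m}) :
  ((cut2 (scaled_wt G k f) A)%:R = cut_wt G A *+ 2 * (k%:R * f%:R) :> rat)%R.
Proof.
rewrite (@total_wt_double _ G (separated A)
  (fun u v => if adj G u v then wt G u v else 0%R)) //; last exact: separated_sym.
rewrite natr_sum mulr_suml; apply: eq_bigr => u _.
rewrite natr_sum mulr_suml; apply: eq_bigr => v _.
by case: ifP => _; rewrite ?mul0r // scaled_wtE.
Qed.

(** If no edge crossed, [A] would be closed under adjacency and hence, by connectivity, contain all
    vertices or none. *)
Lemma scaled_cut_connected (A : {set 'I_m}) :
  (forall u v, connect (adj G) u v) -> A != set0 -> A != setT ->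
  0 < cut2 (scaled_wt G k f) A.
Proof.
move=> conn /set0Pn[u uA] AT; have [v vA] : exists v, v \notin A.
  by move: AT; rewrite -subTset => /subsetPn[v _ vA]; exists v.
rewrite lt0n; apply/eqP => A0; suff /closed_connect cl : closed (adj G) A.
  by have := cl _ _ (conn u v); rewrite uA (negbTE vA).
move=> x y a; apply/eqP; apply: contraT => xy.
move/eqP: A0; rewrite sum_nat_eq0 => /forallP/(_ x)/=.
rewrite sum_nat_eq0 => /forallP/(_ y)/=.
by rewrite /separated xy eqn0Ngt scaled_wt_gt0.
Qed.

End Scaling.

(** * The doubled instance built from a sparsest cut instance *)

Section Instance.
Variable I : sparsest_cut_instance.
Let n := sc_n I.

Definition denominator : nat :=
  (\prod_u \prod_v edge_den (sc_cap I) u v) *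
  (\prod_u \prod_v edge_den (sc_dem I) u v).

Definition cap_wt := scaled_wt (sc_cap I) denominator `|denq (sc_phi0 I)|%N.
Definition dem_wt := scaled_wt (sc_dem I) denominator `|numq (sc_phi0 I)|%N.

(* Plays the role of the infinite weight of the edges joining the two copies of
   a vertex.  No bound on gamma is given, but above the gap gamma * phi0 is less
   than the sparsity of a singleton. *)
Definition pair_wt : nat := (pair_total cap_wt + 1) * (pair_total dem_wt + 1).

Definition reduced_graph : wgraph (2 * n) :=
  @doubled n (adj (sc_cap I)) (adj (sc_dem I)) cap_wt dem_wt pair_wt
    (adj_sym (sc_cap I)) (adj_sym (sc_dem I)) (adj_irr (sc_dem I))
    (scaled_wt_sym _ _ _) (scaled_wt_sym _ _ _).

Lemma reduced_wt_ge0 x y :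
  adj reduced_graph x y -> (0 <= wt reduced_graph x y)%R.
Proof. by move=> _; exact: ler0n. Qed.

Definition reduced_instance : maxcut_instance := MaxCutInstance reduced_wt_ge0.

Lemma prod_gt0 (G : wgraph n) : 0 < \prod_u \prod_v edge_den G u v.
Proof.
by apply: prodn_gt0 => u; apply: prodn_gt0 => v; exact: edge_den_gt0.
Qed.

Lemma denominator_gt0 : 0 < denominator.
Proof. by rewrite muln_gt0 !prod_gt0. Qed.

Lemma dvd_prod_den (G : wgraph n) u v :
  edge_den G u v %| \prod_u \prod_v edge_den G u v.
Proof. by rewrite (bigD1 u) //= (bigD1 v) //= -mulnA dvdn_mulr. Qed.

Lemma dvd_cap u v : edge_den (sc_cap I) u v %| denominator.
Proof. by rewrite dvdn_mulr // dvd_prod_den. Qed.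

Lemma dvd_dem u v : edge_den (sc_dem I) u v %| denominator.
Proof. by rewrite dvdn_mull // dvd_prod_den. Qed.

Lemma phi_den_gt0 : 0 < `|denq (sc_phi0 I)|%N.
Proof. by rewrite absz_gt0 denq_neq0. Qed.

Let scale : rat := (denominator%:R * `|denq (sc_phi0 I)|%N%:R)%R.

Lemma scale_gt0 : (0 < scale)%R.
Proof. by rewrite mulr_gt0 // ltr0n ?denominator_gt0 ?phi_den_gt0. Qed.

Lemma cap_cutE A : ((cut2 cap_wt A)%:R = cut_wt (sc_cap I) A *+ 2 * scale)%R.
Proof.
apply: scaled_cut; [exact: dvd_cap|exact: sc_cap_gt0].
Qed.

(** The numerator of phi0 is phi0 times its denominator, so demands carry phi0 on top of the factor
    [scale] shared with capacities. *)
Lemma dem_cutE A : ((cut2 dem_wt A)%:R =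
  cut_wt (sc_dem I) A *+ 2 * sc_phi0 I * scale)%R.
Proof.
rewrite (scaled_cut _ dvd_dem (@sc_dem_gt0 I)) -pos_ratE ?sc_phi0_gt0 //.
by rewrite /scale; ring.
Qed.

Lemma dem_cut_ge0 A : (0 <= cut_wt (sc_dem I) A)%R.
Proof.
apply: sumr_ge0 => p; rewrite inE => /and3P[_ a _].
exact/ltW/sc_dem_gt0.
Qed.

Lemma sparsity_ltE (R : realType) A :
  (sparsity R A < (ratr (sc_phi0 I))%:E)%E =
  (cut2 cap_wt A < cut2 dem_wt A).
Proof.
rewrite -(ltr_nat rat) cap_cutE dem_cutE ltr_pM2r ?scale_gt0 //.
rewrite mulrnAl ltr_pMn2r // /sparsity; case: eqP => [d0|/eqP d0].
  (* When the sparsity is infinite both sides are false, capacities being nonnegative. *)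
  rewrite d0 mul0r ltNge leey /=; apply/esym/negbTE; rewrite -leNgt.
  by apply: sumr_ge0 => p; rewrite inE => /and3P[_ a _]; exact/ltW/sc_cap_gt0.
rewrite lte_fin ltr_rat ltr_pdivrMr; last by rewrite lt_def d0 dem_cut_ge0.
by rewrite mulrC.
Qed.

Lemma below_thresholdP (R : realType) :
  below_threshold R I <-> exists A, cut2 cap_wt A < cut2 dem_wt A.
Proof.
rewrite /below_threshold /min_sparsity; split=> [/boolp.bigmin_ltP[|]|[A HA]].
- by rewrite ltNge leey.
- by case=> A _; rewrite sparsity_ltE; exists A.
- apply/boolp.bigmin_ltP; right; exists A; last by rewrite sparsity_ltE.
  (* The empty and the full set separate no demand, so a set with larger scaled demand is a proper
     cut. *)
  suff nz B : B = set0 \/ B = setT -> cut2 dem_wt B = 0.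
    by apply/andP; split; apply/eqP => E; move: HA; rewrite (nz A) ?ltn0; auto.
  move=> HB; rewrite /cut2 big1 // => u _; rewrite big1 // => v _.
  by rewrite /separated; case: HB => ->; rewrite !inE.
Qed.

Section AboveGap.
Variables (R : realType) (gamma : nat -> R).
Hypothesis gap : above_gap gamma I.

Lemma gap_cut A : A != set0 -> A != setT ->
  (gamma (2 * n) * (cut2 dem_wt A)%:R < (cut2 cap_wt A)%:R :> R)%R.
Proof.
move=> A0 AT.
have : ((gamma (2 * n) * ratr (sc_phi0 I))%:E < sparsity R A)%E.
  apply: lt_le_trans gap _; apply: bigmin_le_cond; exact/andP.
rewrite /sparsity; case: eqP => [d0 _|/eqP d0].
  (* With infinite sparsity the claim becomes positivity of the capacity, which connectivity
     provides. *)
  have -> : cut2 dem_wt A = 0.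
    by apply/eqP; rewrite -(eqr_nat rat) dem_cutE d0 mul0rn !mul0r.
  rewrite mulr0 ltr0n; apply: scaled_cut_connected => //.
  - exact: denominator_gt0.
  - exact: phi_den_gt0.
  - exact: dvd_cap.
  - exact: sc_cap_gt0.
  - exact: sc_connected.
have dp : (0 < cut_wt (sc_dem I) A)%R by rewrite lt_def d0 dem_cut_ge0.
rewrite lte_fin -(ratr_nat R (cut2 dem_wt A)) -(ratr_nat R (cut2 cap_wt A)).
rewrite cap_cutE dem_cutE => H.
(* Multiplying the bound on the sparsity by this positive [k] clears its denominator. *)
set k := (cut_wt (sc_dem I) A *+ 2 * scale)%R.
have k0 : (0 < ratr k :> R)%R by rewrite ltr0q mulr_gt0 ?scale_gt0 // pmulrn_lgt0.
have -> : (cut_wt (sc_dem I) A *+ 2 * sc_phi0 I * scale = sc_phi0 I * k)%R.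
  by rewrite /k; ring.
have -> : (cut_wt (sc_cap I) A *+ 2 * scale =
    cut_wt (sc_cap I) A / cut_wt (sc_dem I) A * k)%R.
  by rewrite /k; field.
by rewrite !(rmorphM _ _ k) /= mulrA ltr_pM2r.
Qed.

(** The singleton of an endpoint of a demand edge separates an integral scaled demand of at least 1,
    so a positive [gamma] is below the total scaled capacity; [pair_wt] exceeds the product of the
    two totals. *)
Lemma gap_pair_wt : (gamma (2 * n) * (pair_total dem_wt)%:R < pair_wt%:R :> R)%R.
Proof.
have M0 : (0 < pair_wt%:R :> R)%R by rewrite ltr0n muln_gt0 !addn1.
have [g0|g0] := leP (gamma (2 * n)) 0%R.
  by apply: le_lt_trans M0; rewrite mulr_le0_ge0 // ler0n.
have [->|] := posnP (pair_total dem_wt); first by rewrite mulr0.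
rewrite lt0n sum_nat_eq0 negb_forall => /existsP[u] /=.
rewrite sum_nat_eq0 negb_forall => /existsP[v] /= duv.
have a : adj (sc_dem I) u v by apply: contraNT duv => /scaled_wt0 H; rewrite /dem_wt H.
have uv : u != v by apply: contraTneq a => ->; rewrite adj_irr.
have A0 : [set u] != set0 by apply/set0Pn; exists u; rewrite set11.
have AT : [set u] != setT.
  by apply: contra uv => /eqP/setP/(_ v); rewrite !inE eq_sym => ->.
have Y1 : 0 < cut2 dem_wt [set u].
  rewrite /cut2 (bigD1 u) //; apply: leq_trans (leq_addr _ _).
  rewrite (bigD1 v) //; apply: leq_trans (leq_addr _ _).
  by rewrite /separated !inE eqxx eq_sym [v == u]eq_sym (negbTE uv) lt0n.
have gX : (gamma (2 * n) < (pair_total cap_wt)%:R :> R)%R.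
  apply: (@lt_le_trans _ _ (cut2 cap_wt [set u])%:R%R); last first.
    by rewrite ler_nat cut2_le_total.
  by apply: le_lt_trans (gap_cut A0 AT); rewrite ler_peMr ?ler1n // ltW.
apply: (@le_lt_trans _ _ (pair_total cap_wt * pair_total dem_wt)%:R%R).
  by rewrite natrM ler_wpM2r ?ler0n // ltW.
by rewrite ltr_nat /pair_wt; nia.
Qed.

End AboveGap.

Lemma reduced_maxP (R : realType) :
  is_max_cut reduced_graph (left_copy n) <-> ~ below_threshold R I.
Proof.
have dM : pair_total dem_wt <= pair_wt by rewrite /pair_wt; nia.
rewrite left_maxP //; [|exact: scaled_wt0|exact: scaled_wt0].
rewrite below_thresholdP; split=> [H [A]|H A]; first by rewrite ltnNge H.
by rewrite leqNgt; apply/negP => lt; apply: H; exists A.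
Qed.

Lemma reduced_stable (R : realType) (gamma : nat -> R) :
  ~ below_threshold R I -> above_gap gamma I ->
  stable (gamma (2 * n)) reduced_graph.
Proof.
move=> nb gap; apply: left_stable.
- exact: scaled_wt0.
- exact: scaled_wt0.
- exact/reduced_maxP/nb.
- exact: gap_cut.
- exact: gap_pair_wt.
- by rewrite muln_gt0 !addn1.
Qed.

(** * Agreement of the program with the doubled graph *)

Let input := enc_sparsest_cut I.
Let rows (m : nat) (G : wgraph m) := vsnd (enc_graph G).

Lemma big_enum_enc (T : Type) (idx : T) (op : Monoid.com_law idx) m
    (f : 'I_m -> value) (F : value -> T) :
  \big[op/idx]_(r <- vlist (enc_seq [seq f u | u <- enum 'I_m])) F r =
  \big[op/idx]_u F (f u).
Proof. by rewrite enc_seqK big_map big_enum; apply: eq_bigl. Qed.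

Lemma num_vertices_input : num_vertices input = Num n. Proof. by []. Qed.

Lemma common_den_input : common_den input = Num denominator.
Proof.
have H (G : wgraph n) : vprod (fun r => vprod (fun e => entry_den e) r) (rows G) =
    Num (\prod_u \prod_v edge_den G u v).
  rewrite /vprod big_enum_enc; congr Num; apply: eq_bigr => u _.
  rewrite [vnum _]/= big_enum_enc; apply: eq_bigr => v _.
  by rewrite /edge_den; case: ifP.
by rewrite /common_den /cap_rows /dem_rows /= !H.
Qed.

Lemma scaled_input (G : wgraph n) f u v :
  vnum (scaled input (Num f) (if adj G u v then enc_rat (wt G u v) else Num 0)) =
  scaled_wt G denominator f u v.
Proof. by rewrite /scaled common_den_input /scaled_wt /=; case: ifP. Qed.

Lemma total_input (G : wgraph n) f :
  total_entries input (Num f) (rows G) = Num (pair_total (scaled_wt G denominator f)).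
Proof.
rewrite /total_entries /vsum big_enum_enc; congr Num; apply: eq_bigr => u _.
rewrite [vnum _]/= big_enum_enc; apply: eq_bigr => v _.
exact: scaled_input.
Qed.

Lemma penalty_input : penalty input = Num pair_wt.
Proof.
by rewrite /penalty (total_input (sc_cap I)) (total_input (sc_dem I)).
Qed.

Lemma nth_enum_enc m (f : 'I_m -> value) (u : 'I_m) :
  vnth (enc_seq [seq f v | v <- enum 'I_m]) (Num u) = f u.
Proof.
by rewrite /vnth enc_seqK (nth_map u) ?size_enum_ord //= nth_ord_enum.
Qed.

Lemma get_rows (G : wgraph n) (u v : 'I_n) :
  vget (rows G) (Num u) (Num v) =
  if adj G u v then enc_rat (wt G u v) else Num 0.
Proof. by rewrite /vget !nth_enum_enc. Qed.

Lemma in_left_input (x : 'I_(2 * n)) : in_left input (Num x) = Num (side x).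
Proof. by rewrite /in_left num_vertices_input /vleq /= addn1. Qed.

Lemma base_input (x : 'I_(2 * n)) : base_idx input (Num x) = Num (base x).
Proof.
rewrite /base_idx in_left_input num_vertices_input /vif /side /=.
by case: (x < n).
Qed.

Lemma scaled_entry_input (G : wgraph n) f u v :
  scaled_entry input (Num f) (if adj G u v then enc_rat (wt G u v) else Num 0) =
  if adj G u v then Cons (Num (scaled_wt G denominator f u v)) (Num 1) else Num 0.
Proof.
rewrite /scaled_entry -scaled_input; case: ifP => //= _.
Qed.

Lemma entry_input (x y : 'I_(2 * n)) :
  entry input (Num x) (Num y) =
  if adj reduced_graph x y
  then Cons (Num (doubled_wt cap_wt dem_wt pair_wt x y)) (Num 1) else Num 0.
Proof.
rewrite /entry !in_left_input !base_input penalty_input /veq /vif.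
rewrite (get_rows (sc_dem I)) (get_rows (sc_cap I)).
rewrite (@scaled_entry_input (sc_dem I)) (@scaled_entry_input (sc_cap I)).
rewrite /= /doubled_adj /doubled_wt.
have -> : (side x == side y :> nat) = (side x == side y).
  by case: (side x); case: (side y).
have -> : (base x == base y :> nat) = (base x == base y) by [].
case: (side x == side y) => //=.
by case: (base x == base y).
Qed.

Lemma vertices_input : vlist (vertices input) = [seq Num (val x) | x <- enum 'I_(2 * n)].
Proof.
rewrite /vertices num_vertices_input vlist_idx; last first.
  by rewrite enc_seqK size_map size_enum_ord.
by rewrite -val_enum_ord -map_comp.
Qed.

Lemma enc_rat_nat k : enc_rat k%:R = Cons (Num k) (Num 1).
Proof. by rewrite /enc_rat pmulrn numq_int denq_int. Qed.

Lemma reduction_input : reduction input = enc_maxcut reduced_instance.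
Proof.
rewrite /reduction num_vertices_input /vadd /= addnn -mul2n /enc_maxcut /enc_graph /=.
congr (Cons _ _); rewrite /vmap vertices_input -map_comp; congr enc_seq.
apply: eq_map => x /=; rewrite -map_comp; congr enc_seq.
apply: eq_map => y /=; rewrite entry_input /=; case: ifP => // _.
by rewrite enc_rat_nat.
Qed.

Definition enc_members (m : nat) (S : {set 'I_m}) : value :=
  enc_seq [seq Num (u \in S) | u <- enum 'I_m].

Lemma left_side_input : left_side input = enc_members (left_copy n).
Proof.
rewrite /left_side /vmap vertices_input -map_comp; congr enc_seq.
by apply: eq_map => x /=; rewrite in_left_input inE.
Qed.

Lemma weight_input (S : {set 'I_(2 * n)}) :
  weight input (enc_members S) =
  Num (pair_weight cap_wt dem_wt pair_wt (separated S)).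
Proof.
rewrite /weight /vsum vertices_input big_map big_enum; congr Num.
apply: eq_big => // x _ /=; rewrite big_map big_enum.
apply: eq_big => // y _ /=; rewrite !nth_enum_enc entry_input /separated /veq /vif /=.
have -> : (x \in S == (y \in S) :> nat) = ((x \in S) == (y \in S)).
  by case: (x \in S); case: (y \in S).
case: (_ == _) => //=; case: ifPn => //= xy.
(* Absent edges are read as weight 0 by the program, and [doubled_wt] vanishes on them as well. *)
by rewrite (@doubled_wt0 _ _ _ _ _ pair_wt _ _ _ _ xy) //; exact: scaled_wt0.
Qed.

Lemma decision_cut (S : {set 'I_(2 * n)}) : is_max_cut reduced_graph S ->
  decision (Cons input (enc_cut S)) =
  Num (~~ (cut_wt reduced_graph S <= cut_wt reduced_graph (left_copy n))%R).
Proof.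
move=> mx; have -> : enc_cut S = Cons (Num 1) (enc_members S) by [].
rewrite /decision [vfst _]/= [vsnd _]/= left_side_input !weight_input.
rewrite /vif /vsub /vleq /=; congr Num.
rewrite -(@ler_pMn2r _ 2) // !doubled_cut; try exact: scaled_wt0.
by rewrite ler_nat; case: (_ <= _).
Qed.

End Instance.

Theorem theorem3 (R : realType) (gamma : nat -> R) :
  (exists A : program, polytime enc_maxcut A /\ robust_maxcut gamma A) ->
  exists B : program,
    polytime enc_sparsest_cut B /\ decides_sparsest_cut gamma B.
Proof.
move=> [A [pA robust]].
have [B [pB HB]] := polytime_reduction computable_reduction computable_decision
  reduction_input pA.
exists B; split=> // I promise w /HB[w' /robust outA ->].
(* The answer follows [below_threshold], so it is correct even if both alternatives of the promise
   hold. *)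
case: (boolP (min_sparsity R I < (ratr (sc_phi0 I))%:E)%E) => [below|/negP nbelow].
  left; split=> //; case: outA => [[S mx ->]|[-> _] //].
  rewrite decision_cut //; case: (boolP (_ <= _)%R) => // le.
  (* If the maximum cut [S] were no heavier than the cut between the copies, the latter would be
     maximum too. *)
  suff : ~ below_threshold R I by case.
  by apply/reduced_maxP => T; exact: le_trans (mx T) le.
have gap : above_gap gamma I by case: promise.
right; split=> //; case: outA => [[S mx ->]|[_ []]].
  (* The cut between the copies is maximum, so [S] is no heavier and the answer is 0; a bottom
     answer contradicts stability. *)
  have /reduced_maxP left_max := nbelow.
  by rewrite decision_cut // (left_max S).
exact: reduced_stable.
Qed.
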